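(* There is a universal constant $C>0$ with the following property. Suppose that $n\in\mathbb N$ and that $\mathbf X=(\mathbb R^n,\|\cdot\|_{\mathbf X})$ and $\mathbf Y=(\mathbb R^n,\|\cdot\|_{\mathbf Y})$ are two normed spaces. Then for every $\mathscr C\subseteq\mathbb R^n$ containing at least two points, $$\mathsf e(\mathscr C_{\mathbf X})\le C\Bigg(\sup_{x,y\in\mathscr C,\ x\ne y}\frac{\|x-y\|_{\mathbf X}}{\|x-y\|_{\mathbf Y}}\Bigg)\sup_{x,y\in\mathscr C,\ x\ne y}\Bigg(\frac{\mathrm{vol}_{n-1}\big(\mathrm{Proj}_{(x-y)^\perp}B_{\mathbf Y}\big)}{\mathrm{vol}_n(B_{\mathbf Y})}\cdot\frac{\|x-y\|_{\ell_2^n}}{\|x-y\|_{\mathbf X}}\Bigg).$$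
   Context: All vector spaces are over the real scalars. $B_{\mathbf Y}$ is the closed unit ball of $\mathbf Y$; $\mathscr C_{\mathbf X}$ denotes the set $\mathscr C$ equipped with the metric inherited from $\|\cdot\|_{\mathbf X}$; for $z\in\mathbb R^n\setminus\{0\}$, $\mathrm{Proj}_{z^\perp}$ is the orthogonal projection (for the standard Euclidean structure) onto the hyperplane $z^\perp$; $\mathrm{vol}_s$ is $s$-dimensional Hausdorff measure. For a metric space $(\mathcal M,d_{\mathcal M})$, the Lipschitz extension modulus $\mathsf e(\mathcal M)\in[1,\infty]$ is the infimum over those $L\in[1,\infty]$ such that for every nonempty subset $\mathscr S\subseteq\mathcal M$, every Banach space $\mathbf Z$ and every Lipschitz function $f:\mathscr S\to\mathbf Z$ there is $F:\mathcal M\to\mathbf Z$ with $F|_{\mathscr S}=f$ whose Lipschitz constant on $\mathcal M$ is at most $L$ times the Lipschitz constant of $f$ on $\mathscr S$. *)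

(* Defs.v *)
From HB Require Import structures.
From mathcomp Require Import all_boot all_order all_algebra.
From mathcomp Require Import all_classical all_reals all_analysis.

Set Implicit Arguments.
Unset Strict Implicit.
Unset Printing Implicit Defensive.

Import Order.TTheory GRing.Theory Num.Theory.
Import numFieldNormedType.Exports.

Local Open Scope classical_set_scope.
Local Open Scope ring_scope.

(* Several norms on the same space R^n are compared, and 'rV[R]_n already
   carries the sup norm as its canonical one, so a norm is a function. *)
Record is_norm (R : realType) (n : nat) (N : 'rV[R]_n -> R) : Prop := IsNorm {
  is_norm_eq0 : forall x, N x = 0 -> x = 0 ;
  is_normZ : forall (a : R) x, N (a *: x) = `|a| * N x ;
  is_normD : forall x y, N (x + y) <= N x + N y }.

Definition norm_dist (R : realType) (n : nat) (N : 'rV[R]_n -> R)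
  (x y : 'rV[R]_n) : R := N (x - y).

Definition unit_ball (R : realType) (n : nat) (N : 'rV[R]_n -> R) :
  set 'rV[R]_n := [set x | N x <= 1].

Definition dot (R : realType) (n : nat) (x y : 'rV[R]_n) : R :=
  \sum_(i < n) x 0 i * y 0 i.

Definition norm2 (R : realType) (n : nat) (x : 'rV[R]_n) : R :=
  Num.sqrt (dot x x).

Definition proj_perp (R : realType) (n : nat) (z x : 'rV[R]_n) : 'rV[R]_n :=
  x - (dot x z / dot z z) *: z.

Section Hausdorff.
Local Open Scope ereal_scope.

Definition diam (R : realType) (T : Type) (d : T -> T -> R) (A : set T) :
  \bar R := ereal_sup [set t | exists x y, [/\ A x, A y & t = (d x y)%:E]].

(* The empty set is singled out because diam set0 = -oo; a nonempty set has
   diam_pow 0 equal to 1, so 0-dimensional measure is counting measure. *)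
Definition diam_pow (R : realType) (T : Type) (d : T -> T -> R) (s : nat)
  (A : set T) : \bar R := if pselect (A = set0) then 0 else diam d A ^+ s.

Definition hausdorff_content (R : realType) (T : Type) (d : T -> T -> R)
    (s : nat) (delta : R) (A : set T) : \bar R :=
  ereal_inf [set t | exists U : nat -> set T,
    [/\ A `<=` \bigcup_k U k, forall k, diam d (U k) <= delta%:E
      & t = \sum_(0 <= k <oo) diam_pow d s (U k)]].

(* The supremum is the limit as delta tends to 0, by monotonicity. *)
Definition hausdorff (R : realType) (T : Type) (d : T -> T -> R) (s : nat)
    (A : set T) : \bar R :=
  ereal_sup [set hausdorff_content d s delta A | delta in [set e | (0 < e)%R]].

Definition unit_cube (R : realType) (s : nat) : set 'rV[R]_s :=
  [set x | forall i, (0 <= x ord0 i <= 1)%R].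

(* s-dimensional Hausdorff measure on R^n for the Euclidean metric, normalised
   so that the unit cube of R^s has measure 1.  As Hausdorff measure on R^s is
   translation invariant, this is the usual normalisation, under which it is
   Lebesgue measure on R^s. *)
Definition vol (R : realType) (n s : nat) (A : set 'rV[R]_n) : \bar R :=
  hausdorff (norm_dist (@norm2 R n)) s A /
  hausdorff (norm_dist (@norm2 R s)) s (@unit_cube R s).

End Hausdorff.

Section LipschitzExtension.
Local Open Scope ereal_scope.

(* The Lipschitz constant of the restriction of f to S; it is +oo exactly when
   this restriction is not Lipschitz. *)
Definition lip_const (R : realType) (T : Type) (d : T -> T -> R)
    (Z : normedModType R) (S : set T) (f : T -> Z) : \bar R :=
  ereal_inf [set K%:E | K in [set K : R | (0 <= K)%R /\
    forall x y, S x -> S y -> (`|f x - f y| <= K * d x y)%R]].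

(* The Lipschitz extension modulus of the metric space (M, d), where M is a
   subset of T.  Maps defined on a subset of T are total functions whose
   values outside that subset are never used. *)
Definition lip_ext_modulus (R : realType) (T : Type) (d : T -> T -> R)
    (M : set T) : \bar R :=
  ereal_inf [set L : \bar R | 1 <= L /\
    forall (S : set T), S !=set0 -> S `<=` M ->
    forall (Z : completeNormedModType R) (f : T -> Z),
      lip_const d S f < +oo ->
      exists F : T -> Z, (forall x, S x -> F x = f x) /\
        lip_const d M F <= L * lip_const d S f].

End LipschitzExtension.

(* Main.v *)
Require Import Defs.
From HB Require Import structures.
From mathcomp Require Import all_boot all_order all_algebra.
From mathcomp Require Import all_classical all_reals all_analysis.
From mathcomp Require Import measurable_realfun ring lra.

Set Implicit Arguments.
Unset Strict Implicit.
Unset Printing Implicit Defensive.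

Import Order.TTheory GRing.Theory Num.Theory.
Import numFieldNormedType.Exports.

Local Open Scope classical_set_scope.
Local Open Scope ring_scope.

(** Why the theorem is true.

Put M for the first supremum and Q for the second. A function that is
K-Lipschitz for X on a subset S of the given set is KM-Lipschitz for Y on S, so
it is enough to extend from S to R^n a function f that is K-Lipschitz for Y, in
such a way that the extension F satisfies |F x - F y| <= C K q for every q that
dominates, at all scales, the cost of moving a Y-ball by x - y.

Averaging f at scale r. Let B be the unit ball of Y and let the measure of a
piece of R^n be its n-dimensional Hausdorff measure. Cut R^n into countably
many pieces of Y-diameter at most r, choose for every piece a point of S close
to it, and let G_r x be the mean of the values of f at these points, each
weighted by the share of its piece in the ball x + r B. Only finitely many
pieces meet the ball, so the mean is a finite sum. If x is at distance O(r) from S, the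
values that occur differ by O(K r), and moving x to y changes the weights by
the normalised measure of the symmetric difference of x + r B and y + r B
(average_near, average_diff). The radius must not vary with x, for rescaling B
costs a factor n. Hence F interpolates linearly between G_r and G_2r, where r
is the largest power of 2 not above the distance t from x to S. The interpolation
costs O(K |t - t'|), which is O(K) times the Y-distance (interp_diff_scale).
Points at distance 0 from S get their value by completeness
(closure_value). This gives shift_cost_extension.

The cost of moving a ball. The measure of (B + w) \ B is at most 2 |w| times
the volume of the shadow of B along w (hsd_translate_diff). Indeed, by
convexity each of the translates B, B + w, ..., B + k w adds to the union of
the earlier ones a set of the same measure (sweep_step), while all of them lie
in a cylinder over the shadow of length k |w| + O(1). Let k tend to infinity. The
factor 2 pays for shrinking the balls a little, to compare the measure of the
cylinder with that of its base on a grid.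
Together with the case of a w so long that B + w and B are disjoint, which
bounds the Y-norm by the shadow, this turns the abstract cost q into
O(Q |x - y|_X).

Normalisation. Volumes are Hausdorff measures divided by the measure of a unit
cube, so what is needed is that Hausdorff measure is finite and positive on
cubes (hsd_unit_cube_le, hsd_unit_cube_ge1), that balls are measurable for it
(ball_caratheodory), and that a cylinder has at most the measure that Fubini
predicts from its base (hsd_cylinder_grid). Invariance under isometries, which
allows w to be reflected to a coordinate axis, is immediate from the
definition. *)

(** * Hausdorff content and measure as outer measures *)

Section ereal_facts.
Context {R : realType}.
Local Open Scope ereal_scope.

Lemma nneseries_le_bound (u : nat -> \bar R) (M : \bar R) :
  (forall k, 0 <= u k) -> (forall n, \sum_(0 <= k < n) u k <= M) ->
  \sum_(0 <= k <oo) u k <= M.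
Proof.
move=> u0 uM; apply: lime_le; first exact: is_cvg_nneseries.
exact: nearW.
Qed.

(** Interleaving two covers gives a cover of the union. *)
Lemma nneseries_interleave (u v : nat -> \bar R) :
  (forall k, 0 <= u k) -> (forall k, 0 <= v k) ->
  \sum_(0 <= k <oo) (if odd k then v k./2 else u k./2) <=
  \sum_(0 <= k <oo) u k + \sum_(0 <= k <oo) v k.
Proof.
move=> u0 v0; pose w k := if odd k then v k./2 else u k./2.
rewrite -[X in X <= _]/(\sum_(0 <= k <oo) w k).
have w0 k : 0 <= w k by rewrite /w; case: ifP.
apply: nneseries_le_bound => // n.
have wE m : \sum_(0 <= k < m.*2) w k =
    \sum_(0 <= k < m) u k + \sum_(0 <= k < m) v k.
  elim: m => [|m IH]; first by rewrite !big_geq// adde0.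
  rewrite doubleS !big_nat_recr//= IH /w/= odd_double/= doubleK uphalf_double.
  by rewrite -!addeA; congr (_ + _); rewrite addeCA.
apply: (@le_trans _ _ (\sum_(0 <= k < n.*2) w k)).
  rewrite [leRHS](big_cat_nat _ (n := n))//=; last by rewrite -addnn leq_addr.
  by rewrite leeDl// sume_ge0.
by rewrite wE; apply: leeD; apply: nneseries_lim_ge.
Qed.

Lemma le_expe2r (s : nat) (x y : \bar R) : 0 <= x -> x <= y -> x ^+ s <= y ^+ s.
Proof.
move=> x0 xy; elim: s => // s IH; rewrite !expeS.
by apply: lee_pmul => //; exact: expe_ge0.
Qed.

Lemma expeMn_fin (s : nat) (r : R) (x : \bar R) :
  (r%:E * x) ^+ s = (r ^+ s)%:E * x ^+ s.
Proof.
elim: s => [|s IH]; first by rewrite !expe0 expr0 mule1.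
by rewrite !expeS IH exprS EFinM -!muleA; congr (_ * _); rewrite muleCA.
Qed.

End ereal_facts.

Section hausdorff_outer.
Context {R : realType} {T : Type} (d : T -> T -> R) (s : nat).
Hypothesis dxx : forall x, d x x = 0%R.
Local Open Scope ereal_scope.

Lemma le_diam (A B : set T) : A `<=` B -> diam d A <= diam d B.
Proof.
by move=> AB; apply: ereal_sup_le => t [x [y [Ax Ay ->]]]; exists x, y; split;
  [exact: AB|exact: AB|].
Qed.

Lemma dist_le_diam (A : set T) x y : A x -> A y -> (d x y)%:E <= diam d A.
Proof. by move=> Ax Ay; apply: ereal_sup_ubound; exists x, y. Qed.

Lemma diam_ge0 (A : set T) : A !=set0 -> 0 <= diam d A.
Proof. by move=> [x Ax]; apply: le_trans (dist_le_diam Ax Ax); rewrite dxx. Qed.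

Lemma diam_le (A : set T) (r : R) :
  (forall x y, A x -> A y -> (d x y <= r)%R) -> diam d A <= r%:E.
Proof.
by move=> dr; apply: ge_ereal_sup => t [x [y [Ax Ay ->]]]; rewrite lee_fin dr.
Qed.

Lemma diam_pow_set0 : diam_pow d s set0 = 0.
Proof. by rewrite /diam_pow; case: pselect. Qed.

Lemma diam_powE (A : set T) : A !=set0 -> diam_pow d s A = diam d A ^+ s.
Proof. by move=> [x Ax]; rewrite /diam_pow; case: pselect => // A0; rewrite A0 in Ax. Qed.

Lemma diam_pow_ge0 (A : set T) : 0 <= diam_pow d s A.
Proof.
have [->|/set0P A0] := eqVneq A set0; first by rewrite diam_pow_set0.
by rewrite diam_powE// expe_ge0// diam_ge0.
Qed.

Lemma le_diam_pow (A B : set T) : A `<=` B -> diam_pow d s A <= diam_pow d s B.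
Proof.
move=> AB; have [->|/set0P A0] := eqVneq A set0.
  by rewrite diam_pow_set0 diam_pow_ge0.
rewrite !diam_powE//; last by case: A0 => x /AB; exists x.
by apply: le_expe2r; [exact: diam_ge0|exact: le_diam].
Qed.

Lemma content_ge0 delta (A : set T) : 0 <= hausdorff_content d s delta A.
Proof.
apply: le_ereal_inf_tmp => t [U [_ _ ->]]; apply: nneseries_ge0 => *.
exact: diam_pow_ge0.
Qed.

Lemma le_content delta (A B : set T) : A `<=` B ->
  hausdorff_content d s delta A <= hausdorff_content d s delta B.
Proof.
move=> AB; apply: ereal_inf_le_tmp => t [U [BU Ud ->]]; exists U; split => //.
exact: subset_trans BU.
Qed.

Lemma content_le_diam_pow delta (A : set T) : diam d A <= delta%:E ->
  hausdorff_content d s delta A <= diam_pow d s A.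
Proof.
move=> Ad; apply: ereal_inf_lbound.
exists (fun k => if k is 0%N then A else set0); split.
- by move=> x Ax; exists 0%N.
- by case=> // _; apply: diam_le.
- rewrite (nneseries_split 0 1)//=; last by move=> k _; exact: diam_pow_ge0.
  rewrite big_nat1/= eseries0 ?adde0//.
  by case=> // k _ _; exact: diam_pow_set0.
Qed.

Lemma contentU delta (A B : set T) :
  hausdorff_content d s delta (A `|` B) <=
  hausdorff_content d s delta A + hausdorff_content d s delta B.
Proof.
rewrite [X in _ <= X + _]/hausdorff_content.
set SA := [set t | _].
have [->|SA0] := eqVneq (ereal_inf SA) +oo.
  by rewrite addye ?leey// gt_eqF// (lt_le_trans _ (content_ge0 _ _)).
rewrite [X in _ <= _ + X]/hausdorff_content.
set SB := [set t | _].
have [->|SB0] := eqVneq (ereal_inf SB) +oo.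
  by rewrite addey ?leey// gt_eqF// (lt_le_trans _ (content_ge0 delta A)).
have fA : ereal_inf SA \is a fin_num.
  by rewrite ge0_fin_numE ?ltey//; exact: content_ge0.
have fB : ereal_inf SB \is a fin_num.
  by rewrite ge0_fin_numE ?ltey//; exact: content_ge0.
apply/lee_addgt0Pr => e e0.
have e20 : (0 < e / 2)%R by rewrite divr_gt0.
have [_ [U [AU Ud ->]] Ulb] := lb_ereal_inf_adherent e20 fA.
have [_ [V [BV Vd ->]] Vlb] := lb_ereal_inf_adherent e20 fB.
apply: (@le_trans _ _ (\sum_(0 <= k <oo) diam_pow d s (U k) +
                       \sum_(0 <= k <oo) diam_pow d s (V k))); last first.
  rewrite [e in e%:E]splitr EFinD addeACA; apply: leeD; exact: ltW.
apply: le_trans (nneseries_interleave _ _); [|by move=> k; exact: diam_pow_ge0..].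
apply: ereal_inf_lbound.
exists (fun k => if odd k then V k./2 else U k./2); split.
- move=> x [/AU[k _ Ukx]|/BV[k _ Vkx]].
    by exists k.*2 => //=; rewrite odd_double doubleK.
  by exists k.*2.+1 => //=; rewrite odd_double/= uphalf_double.
- by move=> k; case: ifP.
- by apply: congr_lim; apply/funext => n; apply: eq_bigr => k _; case: ifP.
Qed.

Lemma content_set0 delta : hausdorff_content d s delta set0 = 0.
Proof.
apply/eqP; rewrite eq_le content_ge0 andbT -[leRHS]diam_pow_set0.
by apply: content_le_diam_pow; exact: diam_le.
Qed.

Lemma content_bigcup_le delta (I : Type) (r : seq I) (P : pred I) (A : I -> set T) :
  hausdorff_content d s delta (\big[setU/set0]_(i <- r | P i) A i) <=
  \sum_(i <- r | P i) hausdorff_content d s delta (A i).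
Proof.
elim/big_ind2 : _ => //; first by rewrite content_set0.
by move=> X x Y y Xx Yy; apply: le_trans (contentU _ _ _) _; exact: leeD.
Qed.

Lemma content_le_hausdorff delta (A : set T) : (0 < delta)%R ->
  hausdorff_content d s delta A <= hausdorff d s A.
Proof. by move=> d0; apply: ereal_sup_ubound; exists delta. Qed.

Lemma hausdorff_le (A : set T) (M : \bar R) :
  (forall delta, (0 < delta)%R -> hausdorff_content d s delta A <= M) ->
  hausdorff d s A <= M.
Proof. by move=> AM; apply: ge_ereal_sup => _ [delta d0 <-]; exact: AM. Qed.

Lemma hausdorff_ge0 (A : set T) : 0 <= hausdorff d s A.
Proof. exact: le_trans (content_ge0 1 A) (content_le_hausdorff _ ltr01). Qed.

Lemma le_hausdorff (A B : set T) : A `<=` B -> hausdorff d s A <= hausdorff d s B.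
Proof.
move=> AB; apply: hausdorff_le => delta d0.
exact: le_trans (le_content _ AB) (content_le_hausdorff _ d0).
Qed.

Lemma hausdorffU (A B : set T) :
  hausdorff d s (A `|` B) <= hausdorff d s A + hausdorff d s B.
Proof.
apply: hausdorff_le => delta d0; apply: le_trans (contentU _ _ _) _.
by apply: leeD; exact: content_le_hausdorff.
Qed.

Lemma hausdorff_set0 : hausdorff d s set0 = 0.
Proof.
apply/eqP; rewrite eq_le hausdorff_ge0 andbT; apply: hausdorff_le => *.
by rewrite content_set0.
Qed.

(** Covers by sets of diameter below the gap never meet both pieces, so every
    such cover of the union splits into covers of the two pieces. *)
Lemma hausdorff_separated (A B : set T) (eta : R) : (0 < eta)%R ->
  (forall x y, A x -> B y -> (eta <= d x y)%R) ->
  hausdorff d s A + hausdorff d s B <= hausdorff d s (A `|` B).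
Proof.
move=> eta0 AB.
have cAB (delta : R) : (0 < delta)%R -> (delta < eta)%R ->
    hausdorff_content d s delta A + hausdorff_content d s delta B <=
    hausdorff d s (A `|` B).
  move=> d0 deta; apply: le_trans (content_le_hausdorff _ d0).
  apply: le_ereal_inf_tmp => _ [U [ABU Ud ->]].
  apply: (@le_trans _ _ (\sum_(0 <= k <oo) diam_pow d s (U k `&` A) +
                         \sum_(0 <= k <oo) diam_pow d s (U k `&` B))).
    apply: leeD; apply: ereal_inf_lbound.
    - exists (fun k => U k `&` A); split => //.
        by move=> x Ax; have [k _ Ukx] := ABU _ (or_introl Ax); exists k.
      by move=> k; apply: le_trans (Ud k); apply: le_diam; exact: subIsetl.
    - exists (fun k => U k `&` B); split => //.
        by move=> x Bx; have [k _ Ukx] := ABU _ (or_intror Bx); exists k.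
      by move=> k; apply: le_trans (Ud k); apply: le_diam; exact: subIsetl.
  rewrite -nneseriesD//; [|by move=> *; exact: diam_pow_ge0..].
  apply: lee_nneseries => [k _ _|k _].
    by apply: adde_ge0; exact: diam_pow_ge0.
  have [UA0|/set0P[x [Ux Ax]]] := eqVneq (U k `&` A) set0.
    by rewrite UA0 diam_pow_set0 add0e le_diam_pow//; exact: subIsetl.
  have [UB0|/set0P[y [Uy By]]] := eqVneq (U k `&` B) set0.
    by rewrite UB0 diam_pow_set0 adde0 le_diam_pow//; exact: subIsetl.
  have := le_trans (dist_le_diam Ux Uy) (Ud k).
  by rewrite lee_fin leNgt (lt_le_trans deta)// AB.
have mono delta delta' X : (delta <= delta')%R ->
    hausdorff_content d s delta' X <= hausdorff_content d s delta X.
  move=> dd; apply: ereal_inf_le_tmp => t [U [XU Ud ->]]; exists U; split => //.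
  by move=> k; rewrite (le_trans (Ud k))// lee_fin.
have cAB2 (delta delta' : R) : (0 < delta)%R -> (0 < delta')%R ->
    hausdorff_content d s delta A + hausdorff_content d s delta' B <=
    hausdorff d s (A `|` B).
  (* Contents decrease with the mesh, so one mesh below the gap serves both. *)
  move=> d0 d'0; pose m : R := Num.min (Num.min delta delta') (eta / 2)%R.
  have m0 : (0 < m)%R by rewrite !lt_min d0 d'0 divr_gt0.
  have meta : (m < eta)%R by rewrite gt_min ltr_pdivrMr// mulr2n mulrDr mulr1 ltrDl eta0 orbT.
  apply: le_trans (cAB _ m0 meta); apply: leeD; apply: mono.
    by rewrite !ge_min lexx.
  by rewrite !ge_min lexx orbT.
have [->|Moo] := eqVneq (hausdorff d s (A `|` B)) +oo; first by rewrite leey.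
have fM : hausdorff d s (A `|` B) \is a fin_num.
  by rewrite ge0_fin_numE ?ltey ?hausdorff_ge0.
have fle X : X <= hausdorff d s (A `|` B) -> 0 <= X -> X \is a fin_num.
  by move=> XM X0; rewrite ge0_fin_numE// (le_lt_trans XM)// ltey.
rewrite -leeBrDr//; last by apply: fle; rewrite ?hausdorff_ge0// le_hausdorff//; exact: subsetUr.
apply: hausdorff_le => delta d0.
have fA : hausdorff_content d s delta A \is a fin_num.
  apply: fle; rewrite ?content_ge0//; apply: le_trans (content_le_hausdorff _ d0) _.
  by apply: le_hausdorff; exact: subsetUl.
rewrite leeBrDr; last by apply: fle; rewrite ?hausdorff_ge0// le_hausdorff//; exact: subsetUr.
rewrite addeC -leeBrDr//; apply: hausdorff_le => delta' d'0.
by rewrite leeBrDr// addeC cAB2.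
Qed.

End hausdorff_outer.

(** Every invariance of Hausdorff measure is an instance of this estimate:
    isometries, translations, dilations and orthogonal projections. *)
Lemma hausdorff_lipschitz (R : realType) (T1 T2 : Type) (d1 : T1 -> T1 -> R)
    (d2 : T2 -> T2 -> R) (s : nat) (L : R) (phi : T1 -> T2) (A : set T1) :
  (forall x, d1 x x = 0) -> (forall x, d2 x x = 0) -> 0 < L ->
  (forall x y, A x -> A y -> d2 (phi x) (phi y) <= L * d1 x y) ->
  (hausdorff d2 s (phi @` A) <= (L ^+ s)%:E * hausdorff d1 s A)%E.
Proof.
move=> d10 d20 L0 phiL; apply: hausdorff_le => // delta delta0.
have Ls0 : 0 < L ^+ s by rewrite exprn_gt0.
apply: (@le_trans _ _ ((L ^+ s)%:E * hausdorff_content d1 s (delta / L) A)%E); last first.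
  by rewrite lee_pmul2l//; apply: content_le_hausdorff; rewrite divr_gt0.
rewrite -lee_pdivrMl//; apply: le_ereal_inf_tmp => _ [U [AU Ud ->]].
have diamU k : (diam d2 (phi @` (U k `&` A)) <= L%:E * diam d1 (U k))%E.
  apply: ge_ereal_sup => _ [_ [_ [[x [Ux Ax] <-] [y [Uy Ay] <-] ->]]].
  apply: (@le_trans _ _ (L * d1 x y)%:E); first by rewrite lee_fin phiL.
  by rewrite EFinM lee_pmul2l//; exact: dist_le_diam.
rewrite lee_pdivrMl// -nneseriesZl//; last by move=> k _; exact: diam_pow_ge0.
apply: (@le_trans _ _ (\sum_(0 <= k <oo) diam_pow d2 s (phi @` (U k `&` A)))%E).
  apply: ereal_inf_lbound; exists (fun k => phi @` (U k `&` A)); split => //.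
    by move=> _ [x Ax <-]; have [k _ Ux] := AU _ Ax; exists k => //; exists x.
  move=> k; apply: le_trans (diamU k) _; rewrite -lee_pdivlMl// -EFinM mulrC.
  exact: Ud.
apply: lee_nneseries => [k _ _|k _]; first exact: diam_pow_ge0.
have [->|/set0P UA0] := eqVneq (U k `&` A) set0.
  by rewrite image_set0 diam_pow_set0 mule_ge0// ?diam_pow_ge0// lee_fin ltW.
rewrite !diam_powE//; last 2 first.
- by case: UA0 => x [Ux _]; exists x.
- by case: UA0 => x UAx; exists (phi x); exists x.
rewrite -expeMn_fin; apply: le_expe2r; last exact: diamU.
by apply: diam_ge0 => //; case: UA0 => x UAx; exists (phi x); exists x.
Qed.

Section hausdorff_cover.
Context {R : realType} {T : Type} (d : T -> T -> R) (s : nat).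
Hypothesis dxx : forall x, d x x = 0%R.
Local Open Scope ereal_scope.

Lemma content_cover delta (I : finType) (P : {pred I}) (F : I -> set T)
    (A : set T) (c : R) :
  (forall x, A x -> exists2 i, i \in P & F i x) ->
  (forall i, i \in P -> hausdorff_content d s delta (F i) <= c%:E) ->
  hausdorff_content d s delta A <= (#|P|%:R * c)%:E.
Proof.
move=> AF Fc; rewrite mulr_natl -sumr_const -sumEFin.
have AU : A `<=` \big[setU/set0]_(i in P) F i.
  by rewrite -bigcup_pred => x /AF[i Pi Fx]; exists i.
apply: le_trans (le_content d s delta AU) _.
by apply: le_trans (content_bigcup_le _ dxx _ _ _ _) _; apply: lee_sum.
Qed.

Lemma hausdorff_cover (I : finType) (P : {pred I}) (F : I -> set T)
    (A : set T) (c : R) :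
  (forall x, A x -> exists2 i, i \in P & F i x) ->
  (forall i, i \in P -> hausdorff d s (F i) <= c%:E) ->
  hausdorff d s A <= (#|P|%:R * c)%:E.
Proof.
move=> AF Fc; apply: hausdorff_le => delta d0.
apply: content_cover AF _ => i Pi.
exact: le_trans (content_le_hausdorff _ _ _ d0) (Fc _ Pi).
Qed.

End hausdorff_cover.

(** * Euclidean Hausdorff measure: invariances and cubes *)

Section euclidean_norm.
Context {R : realType}.
Implicit Types n : nat.

Lemma dot_ge0 n (x : 'rV[R]_n) : 0 <= dot x x.
Proof. by apply: sumr_ge0 => i _; rewrite -expr2 sqr_ge0. Qed.

Lemma norm2_ge0 n (x : 'rV[R]_n) : 0 <= norm2 x.
Proof. exact: sqrtr_ge0. Qed.

Lemma sqr_norm2 n (x : 'rV[R]_n) : norm2 x ^+ 2 = dot x x.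
Proof. by rewrite sqr_sqrtr// dot_ge0. Qed.

Lemma dotZ n (a : R) (x : 'rV[R]_n) : dot (a *: x) (a *: x) = a ^+ 2 * dot x x.
Proof.
by rewrite /dot mulr_sumr; apply: eq_bigr => i _; rewrite !mxE; ring.
Qed.

Lemma norm2Z n (a : R) (x : 'rV[R]_n) : norm2 (a *: x) = `|a| * norm2 x.
Proof. by rewrite /norm2 dotZ sqrtrM ?sqr_ge0// sqrtr_sqr. Qed.

Lemma norm2_0 n : norm2 (0 : 'rV[R]_n) = 0.
Proof. by rewrite -(scale0r (0 : 'rV[R]_n)) norm2Z normr0 mul0r. Qed.

Lemma norm_dist2_xx n (x : 'rV[R]_n) : norm_dist (@norm2 R n) x x = 0.
Proof. by rewrite /norm_dist subrr norm2_0. Qed.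

Lemma coord_le_norm2 n (x : 'rV[R]_n) i : `|x 0 i| <= norm2 x.
Proof.
rewrite -[leLHS]ger0_norm// -ler_sqr ?nnegrE ?norm2_ge0// sqr_norm2 ger0_norm//.
rewrite real_normK ?num_real// /dot (bigD1 i)//= -expr2 lerDl.
by apply: sumr_ge0 => j _; rewrite -expr2 sqr_ge0.
Qed.

Lemma norm2_le_coord n (x : 'rV[R]_n) (r : R) :
  0 <= r -> (forall i, `|x 0 i| <= r) -> norm2 x <= n%:R * r.
Proof.
move=> r0 xr; rewrite -ler_sqr ?nnegrE ?norm2_ge0 ?mulr_ge0// sqr_norm2.
apply: (@le_trans _ _ (n%:R * r ^+ 2)).
  rewrite mulr_natl -[X in _ *+ X]card_ord -sumr_const; apply: ler_sum => i _.
  rewrite -expr2 -real_normK ?num_real//.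
  by rewrite ler_sqr ?nnegrE.
rewrite exprMn ler_wpM2r ?sqr_ge0// -natrX ler_nat.
by case: n {x xr} => // n; rewrite expnS expn1 leq_pmulr.
Qed.

Lemma norm2_eq0 n (x : 'rV[R]_n) : norm2 x = 0 -> x = 0.
Proof.
move=> x0; apply/rowP => i; rewrite mxE; apply/eqP; rewrite -normr_le0 -x0.
exact: coord_le_norm2.
Qed.

End euclidean_norm.

(** Euclidean Hausdorff measure, not normalised. *)
Notation hsd s A := (hausdorff (norm_dist (@norm2 _ _)) s A).

Section euclidean_hausdorff.
Context {R : realType}.
Local Open Scope ereal_scope.

Lemma hsd_lipschitz n m (s : nat) (L : R) (phi : 'rV[R]_n -> 'rV[R]_m)
    (A : set 'rV[R]_n) : (0 < L)%R ->
  (forall x y, norm2 (phi x - phi y) <= L * norm2 (x - y))%R ->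
  hsd s (phi @` A) <= (L ^+ s)%:E * hsd s A.
Proof.
move=> L0 phiL; apply: hausdorff_lipschitz => //; [exact: norm_dist2_xx..|].
by move=> x y _ _; exact: phiL.
Qed.

Lemma hsd_contraction n m (s : nat) (phi : 'rV[R]_n -> 'rV[R]_m)
    (A : set 'rV[R]_n) :
  (forall x y, norm2 (phi x - phi y) <= norm2 (x - y))%R ->
  hsd s (phi @` A) <= hsd s A.
Proof.
move=> phiL; have := @hsd_lipschitz n m s 1%R phi A ltr01.
by rewrite expr1n mul1e; apply => x y; rewrite mul1r.
Qed.

Lemma hsd_translate n s (v : 'rV[R]_n) (A : set 'rV[R]_n) :
  hsd s ((fun x => x + v)%R @` A) = hsd s A.
Proof.
have le w B : hsd s ((fun x : 'rV[R]_n => x + w)%R @` B) <= hsd s B.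
  by apply: hsd_contraction => x y; rewrite opprD addrACA subrr addr0.
apply/eqP; rewrite eq_le le/=.
rewrite [in leLHS](_ : A = (fun x => x - v)%R @` ((fun x => x + v)%R @` A)) ?le//.
by rewrite image_comp/= -[LHS]image_id; apply: eq_imagel => x _ /=; rewrite addrK.
Qed.

Lemma hsd_scale n s (a : R) (A : set 'rV[R]_n) : (0 < a)%R ->
  hsd s ((fun x => a *: x)%R @` A) = (a ^+ s)%:E * hsd s A.
Proof.
have le b B : (0 < b)%R ->
    hsd s ((fun x : 'rV[R]_n => b *: x)%R @` B) <= (b ^+ s)%:E * hsd s B.
  by move=> b0; apply: hsd_lipschitz => // x y; rewrite -scalerBr norm2Z gtr0_norm.
move=> a0; apply/eqP; rewrite eq_le le//=.
rewrite [in leLHS](_ : A = (fun x => a^-1 *: x)%R @` ((fun x => a *: x)%R @` A)).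
  rewrite -lee_pdivlMl ?exprn_gt0//.
  by rewrite -exprVn; apply: le; rewrite invr_gt0.
rewrite image_comp/= -[LHS]image_id; apply: eq_imagel => x _ /=.
by rewrite scalerA mulVf ?gt_eqF// scale1r.
Qed.

Definition cube n (a : 'rV[R]_n) (e : R) : set 'rV[R]_n :=
  [set y | forall i, (a 0 i <= y 0 i <= a 0 i + e)%R].

Lemma cube_image n (a : 'rV[R]_n) (e : R) : (0 < e)%R ->
  cube a e = (fun x => x + a)%R @` ((fun x => e *: x)%R @` @unit_cube R n).
Proof.
move=> e0; apply/seteqP; split => [y ya|_ [_ [x x01 <-] <-] i].
  exists (y - a)%R; last by rewrite subrK.
  exists (e^-1 *: (y - a))%R; last by rewrite scalerA divff ?gt_eqF// scale1r.
  move=> i; have /andP[h1 h2] := ya i; rewrite !mxE.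
  rewrite mulr_ge0 ?invr_ge0 ?(ltW e0) ?subr_ge0//=.
  by rewrite ler_pdivrMl// mulr1 lerBlDl.
rewrite !mxE; have /andP[h1 h2] := x01 i.
rewrite lerDr mulr_ge0 ?(ltW e0)//= addrC lerD2l.
by rewrite -[leRHS]mulr1 ler_pM2l.
Qed.

Lemma hsd_cube n s (a : 'rV[R]_n) (e : R) : (0 < e)%R ->
  hsd s (cube a e) = (e ^+ s)%:E * hsd s (@unit_cube R n).
Proof. by move=> e0; rewrite cube_image// hsd_translate hsd_scale. Qed.

(** Closed cells, so that the right end N is in the last one. *)
Lemma cell_index (N : nat) (t : R) : (0 <= t <= N%:R)%R -> (0 < N)%N ->
  exists p : 'I_N, (p%:R <= t <= p%:R + 1)%R.
Proof.
move=> /andP[t0 tN] N0.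
have /andP[h1 h2] := truncn_itv t0.
have [tlt|tge] := ltnP (Num.truncn t) N.
  by exists (Ordinal tlt); rewrite /= h1 natr1 ltW.
have pN : (N.-1 < N)%N by rewrite prednK.
exists (Ordinal pN) => /=; rewrite natr1 prednK// tN andbT.
by apply: le_trans h1; rewrite ler_nat (leq_trans (leq_pred N)).
Qed.

Definition subcube n (a : 'rV[R]_n) (e : R) (N : nat) (p : {ffun 'I_n -> 'I_N}) :=
  cube (a + e *: \row_i ((p i)%:R : R))%R e.

Lemma subcube_cover n (a : 'rV[R]_n) (e : R) (N : nat) : (0 < e)%R -> (0 < N)%N ->
  forall y, cube a (N%:R * e) y ->
  exists2 p : {ffun 'I_n -> 'I_N}, p \in predT & subcube a e p y.
Proof.
move=> e0 N0 y ya.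
have /choice[p pP] : forall i, exists p : 'I_N, 
    (p%:R <= (y 0 i - a 0 i) / e <= p%:R + 1)%R.
  move=> i; apply: cell_index => //; have /andP[h1 h2] := ya i.
  by rewrite divr_ge0 ?subr_ge0 ?(ltW e0)//= ler_pdivrMr// lerBlDl.
exists [ffun i => p i] => // i; rewrite !mxE ffunE.
have /andP[h1 h2] := pP i.
move: h1 h2; rewrite ler_pdivlMr// ler_pdivrMr// => h1 h2.
apply/andP; split.
- by rewrite -lerBrDl mulrC.
- by move: h2; rewrite lerBlDl mulrDl mul1r addrA [(_ * e)%R]mulrC.
Qed.

Lemma card_cells n N : #|{ffun 'I_n -> 'I_N}| = (N ^ n)%N.
Proof. by rewrite card_ffun !card_ord. Qed.

(** The grid of mesh 1/N covers the cube by N^n cells of diameter at most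
    n/N. *)
Lemma hsd_unit_cube_le n : hsd n (@unit_cube R n) <= (n%:R ^+ n)%:E.
Proof.
apply: hausdorff_le => delta d0.
pose N := (Num.truncn (n%:R / delta)).+1.
have nN : (n%:R / delta < N%:R)%R.
  by have /andP[] := @truncn_itv _ (n%:R / delta)%R (divr_ge0 (ler0n _ _) (ltW d0)).
have N0 : (0 < N%:R :> R)%R by rewrite ltr0n.
have e0 : (0 < N%:R^-1 :> R)%R by rewrite invr_gt0.
have sd p : diam (norm_dist (@norm2 R n)) (subcube 0 N%:R^-1 (p : {ffun 'I_n -> 'I_N}))
    <= (n%:R / N%:R)%:E.
  apply: diam_le => x y xp yp; apply: norm2_le_coord; first exact: ltW.
  move=> i; rewrite !mxE ler_norml; have := xp i; have := yp i; lra.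
apply: (@le_trans _ _ ((N ^ n)%:R * (n%:R / N%:R) ^+ n)%:E).
  rewrite -(card_cells n N); apply: content_cover.
  - exact: norm_dist2_xx.
  - move=> x x01; apply: (@subcube_cover n 0%R N%:R^-1 N) => // i.
    by rewrite mxE add0r divff ?gt_eqF.
  - move=> p _; apply: le_trans (content_le_diam_pow _ _ _) _.
    + exact: norm_dist2_xx.
    + by apply: le_trans (sd p) _; rewrite lee_fin ler_pdivrMr// mulrC -ler_pdivrMr// ltW.
    + rewrite diam_powE; last first.
        exists (0 + N%:R^-1 *: \row_i ((p i)%:R : R))%R => i.
        by rewrite lexx lerDl ltW.
      rewrite EFin_expe; apply: le_expe2r => //.
      apply: diam_ge0; first exact: norm_dist2_xx.
      exists (0 + N%:R^-1 *: \row_i ((p i)%:R : R))%R => i.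
      by rewrite lexx lerDl ltW.
by rewrite lee_fin natrX -exprMn mulrC mulfVK ?gt_eqF.
Qed.

End euclidean_hausdorff.

(** * Positivity of the measure of a cube *)

Section cube_positive.
Context {R : realType}.

Definition consrow n (t : R) (v : 'rV[R]_n) : 'rV[R]_n.+1 :=
  \row_i (if unlift ord0 i is Some j then v 0 j else t).

Lemma consrow0 n t (v : 'rV[R]_n) : consrow t v 0 ord0 = t.
Proof. by rewrite mxE unlift_none. Qed.

Lemma consrowS n t (v : 'rV[R]_n) j : consrow t v 0 (lift ord0 j) = v 0 j.
Proof. by rewrite mxE liftK. Qed.

Lemma norm2_consrowB n t (v w : 'rV[R]_n) :
  norm2 (consrow t v - consrow t w) = norm2 (v - w).
Proof.
congr Num.sqrt; rewrite /dot big_ord_recl !mxE unlift_none subrr mulr0 add0r.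
by apply: eq_bigr => i _; rewrite !mxE liftK.
Qed.

Local Open Scope ereal_scope.

Definition slice n (U : set 'rV[R]_n.+1) (t : R) : set 'rV[R]_n :=
  [set v | U (consrow t v)].

(** The product g.1 times the indicator of g.2 is a measurable majorant, as a
    function of the first coordinate, of the contribution of U to the covers of
    the slices. The slices of a set of diameter d are empty outside an interval of length
    d, and have diameter at most d. *)
Lemma slice_bound n (U : set 'rV[R]_n.+1) :
  diam (norm_dist (@norm2 R n.+1)) U <= 1%:E ->
  exists g : R * set R, [/\ (0 <= g.1)%R, measurable g.2,
    g.1%:E * lebesgue_measure g.2 <= diam_pow (norm_dist (@norm2 R n.+1)) n.+1 U &
    forall t, diam_pow (norm_dist (@norm2 R n)) n (slice U t) <=
      g.1%:E * (\1_(g.2) t)%:E].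
Proof.
move=> Ud.
have [->|/set0P U0] := eqVneq U set0.
  exists (0%R, set0); split => //=; first by rewrite mul0e diam_pow_set0.
  by move=> t; rewrite mul0e (_ : slice _ _ = set0) ?diam_pow_set0.
have d0 := diam_ge0 (@norm_dist2_xx R n.+1) U0.
have dfin : diam (norm_dist (@norm2 R n.+1)) U \is a fin_num.
  by rewrite ge0_fin_numE// (le_lt_trans Ud) ?ltry.
set D := fine (diam (norm_dist (@norm2 R n.+1)) U).
have DE : diam (norm_dist (@norm2 R n.+1)) U = D%:E by rewrite fineK.
have D0 : (0 <= D)%R by rewrite -lee_fin -DE.
have [u Uu] := U0.
pose E := [set x 0 ord0 | x in U]%R.
have dist0 x y : U x -> U y -> (`|x 0 ord0 - y 0 ord0| <= D)%R.
  move=> Ux Uy; apply: (@le_trans _ _ (norm2 (x - y))).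
    by have := coord_le_norm2 (x - y) ord0; rewrite !mxE.
  by rewrite -lee_fin -DE; exact: dist_le_diam.
have Elb : has_lbound E.
  exists (u 0 ord0 - D)%R => _ [x Ux <-].
  by have := dist0 _ _ Uu Ux; rewrite ler_norml; lra.
have E0 : E !=set0 by exists (u 0 ord0)%R; exists u.
have infE (x : 'rV_n.+1) : U x -> (inf E <= x 0 ord0 <= inf E + D)%R.
  move=> Ux; apply/andP; split; first by apply: ge_inf => //; exists x.
  rewrite -lerBlDr; apply: lb_le_inf => // _ [y Uy <-].
  by have := dist0 _ _ Ux Uy; rewrite ler_norml; lra.
exists ((D ^+ n)%R, `[inf E, (inf E + D)%R]%classic); split => /=.
- by rewrite exprn_ge0.
- exact: measurable_itv.
- rewrite lebesgue_measure_itv/= lte_fin ltrDl diam_powE// DE -EFin_expe.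
  case: ifPn => [Dgt0|_]; last by rewrite mule0 lee_fin exprn_ge0.
  by rewrite -EFinB addrAC subrr add0r -EFinM -exprSr.
- move=> t; have [->|/set0P[v Uv]] := eqVneq (slice U t) set0.
    by rewrite diam_pow_set0 mule_ge0// lee_fin ?exprn_ge0.
  rewrite indicE mem_set/=; last first.
    by rewrite in_itv/=; have := infE _ Uv; rewrite consrow0.
  rewrite mule1 diam_powE; last by exists v.
  rewrite EFin_expe; apply: le_expe2r.
    by apply: diam_ge0; [exact: norm_dist2_xx|exists v].
  apply: diam_le => x y Ux Uy; rewrite /norm_dist -(norm2_consrowB t).
  by rewrite -lee_fin -DE; exact: dist_le_diam.
Qed.

(** Slice the cube in the first coordinate: every slice of a cover of the
    (n+1)-cube covers the n-cube, so integrating the inductive bound over the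
    first coordinate proves the bound one dimension up. *)
Lemma cover_unit_cube_ge1 n (U : nat -> set 'rV[R]_n) :
  (forall k, diam (norm_dist (@norm2 R n)) (U k) <= 1%:E) ->
  @unit_cube R n `<=` \bigcup_k U k ->
  1 <= \sum_(0 <= k <oo) diam_pow (norm_dist (@norm2 R n)) n (U k).
Proof.
elim: n U => [|n IH] U Ud cU.
  have [k _ Uk0] : (\bigcup_k U k) 0%R by apply: cU => -[].
  apply: (@le_trans _ _ (\sum_(0 <= i < k.+1) diam_pow (norm_dist (@norm2 R 0)) 0 (U i))).
    rewrite big_nat_recr//= diam_powE; last by exists 0%R.
    rewrite expe0 leeDr// sume_ge0// => i _.
    by apply: diam_pow_ge0; exact: norm_dist2_xx.
  by apply: nneseries_lim_ge => i _ _; apply: diam_pow_ge0; exact: norm_dist2_xx.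
have /choice[g gP] := fun k => slice_bound (Ud k).
pose f k (t : R) := (g k).1%:E * (\1_(g k).2 t)%:E.
have f0 k t : 0 <= f k t.
  by have [g0 _ _ _] := gP k; rewrite /f -EFinM lee_fin mulr_ge0.
pose I : set R := `[0%R, 1%R]%classic.
have mf k : measurable_fun I (f k).
  have [_ mg _ _] := gP k.
  by apply: measurable_funeM; apply/measurable_EFinP; apply: measurable_indic.
have I01 : lebesgue_measure I = 1.
  by rewrite /I lebesgue_measure_itv/= lte_fin ltr01 -EFinB subr0.
have mI : measurable I by exact: measurable_itv.
have int1 : \int[lebesgue_measure]_(t in I) cst 1 t = 1 :> \bar R.
  by rewrite integral_cst// mul1e.
rewrite -[leLHS]int1.
apply: (@le_trans _ _ (\int[lebesgue_measure]_(t in I)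
    \sum_(0 <= k <oo) f k t)).
  apply: ge0_le_integral => //.
  - by apply: (@ge0_emeasurable_sum _ _ _ _ f predT).
  - move=> t t01; apply: (@le_trans _ _ (\sum_(0 <= k <oo)
        diam_pow (norm_dist (@norm2 R n)) n (slice (U k) t))).
      apply: IH.
        move=> k; apply: diam_le => x y Ux Uy; rewrite /norm_dist -(norm2_consrowB t).
        by rewrite -lee_fin; apply: le_trans (Ud k); exact: dist_le_diam.
      move=> v v01; have [|k _ Uk] := cU (consrow t v); last by exists k.
      move=> i; case: (unliftP ord0 i) => [j ->|->].
        by rewrite consrowS.
      by rewrite consrow0; move: t01; rewrite /I/= in_itv.
    apply: lee_nneseries => [k _ _|k _]; last by have [] := gP k.
    by apply: diam_pow_ge0; exact: norm_dist2_xx.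
rewrite integral_nneseries//.
apply: lee_nneseries => [k _ _|k _]; first by apply: integral_ge0.
have [g0 mg gU _] := gP k; apply: le_trans gU.
rewrite /f ge0_integralZl//; last by apply/measurable_EFinP; apply: measurable_indic.
rewrite integral_indic//; apply: lee_pmul => //.
by apply: le_measure; rewrite ?inE//; exact: measurableI.
Qed.

Lemma hsd_unit_cube_ge1 n : 1 <= hsd n (@unit_cube R n).
Proof.
apply: le_trans (content_le_hausdorff _ _ _ ltr01).
by apply: le_ereal_inf_tmp => _ [U [cU Ud ->]]; exact: cover_unit_cube_ge1.
Qed.

Definition cube_measure n : R := fine (hsd n (@unit_cube R n)).

Lemma cube_measureE n : hsd n (@unit_cube R n) = (cube_measure n)%:E.
Proof.
rewrite /cube_measure fineK// ge0_fin_numE; first exact: le_lt_trans (hsd_unit_cube_le n) (ltry _).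
exact: le_trans (hsd_unit_cube_ge1 n).
Qed.

Lemma cube_measure_gt0 n : (0 < cube_measure n)%R.
Proof. by rewrite -lte_fin -cube_measureE (lt_le_trans _ (hsd_unit_cube_ge1 n)). Qed.

End cube_positive.

(** * Norms on R^n *)

Section norm_theory.
Context {R : realType} {n : nat} (N : 'rV[R]_n -> R).
Hypothesis normN : is_norm N.

Lemma norm0 : N 0 = 0.
Proof. by rewrite -(scale0r (0 : 'rV_n)) (is_normZ normN) normr0 mul0r. Qed.

Lemma normNx x : N (- x) = N x.
Proof. by rewrite -scaleN1r (is_normZ normN) normrN1 mul1r. Qed.

Lemma normBC x y : N (x - y) = N (y - x).
Proof. by rewrite -opprB normNx. Qed.

Lemma norm_ge0 x : 0 <= N x.
Proof.
have := is_normD normN x (- x).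
by rewrite subrr norm0 normNx -mulr2n pmulrn_lge0.
Qed.

Lemma norm_gt0 x : x != 0 -> 0 < N x.
Proof.
move=> x0; rewrite lt_neqAle norm_ge0 andbT eq_sym; apply: contra_neq x0.
exact: is_norm_eq0.
Qed.

Lemma norm_triangle z x y : N (x - y) <= N (x - z) + N (z - y).
Proof. by rewrite -[x - y](subrKA z); exact: is_normD. Qed.

Lemma norm_le_dist x y : N x <= N y + N (x - y).
Proof. by rewrite -[in leLHS](subrK y x) addrC; exact: is_normD. Qed.

Lemma norm_sum_le (I : Type) (r : seq I) (F : I -> 'rV_n) :
  N (\sum_(i <- r) F i) <= \sum_(i <- r) N (F i).
Proof.
elim/big_ind2 : _ => //; first by rewrite norm0.
by move=> x1 x2 y1 y2 h1 h2; apply: le_trans (is_normD normN _ _) _; exact: lerD.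
Qed.

Lemma norm_le_norm2 : exists2 K, 0 < K & forall x, N x <= K * norm2 x.
Proof.
exists (\sum_i N (delta_mx 0 i) + 1).
  by rewrite ltr_wpDl// sumr_ge0// => i _; exact: norm_ge0.
move=> x; rewrite [in leLHS](row_sum_delta x).
apply: (le_trans (norm_sum_le _ _)).
apply: (@le_trans _ _ (\sum_i norm2 x * N (delta_mx 0 i))).
  apply: ler_sum => i _; rewrite (is_normZ normN).
  by apply: ler_wpM2r; [exact: norm_ge0|exact: coord_le_norm2].
by rewrite -mulr_sumr mulrC ler_wpM2r ?norm2_ge0// lerDl.
Qed.

End norm_theory.

Lemma coord_le_mx_norm {R : realType} {n : nat} (x : 'rV[R]_n) i : `|x 0 i| <= `|x|.
Proof.
rewrite -[leRHS]/(mx_norm x) mx_normrE.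
exact: (le_bigmax _ (fun ij : 'I_1 * 'I_n => `|x ij.1 ij.2|) (0, i)).
Qed.

(** By compactness of the unit sphere of the sup norm, on which N has a positive
    minimum. *)
Lemma norm_ge_norm2 (R : realType) (n : nat) (N : 'rV[R]_n.+1 -> R) :
  is_norm N -> exists2 c, 0 < c & forall x, c * norm2 x <= N x.
Proof.
move=> normN; have [K K0 NK] := norm_le_norm2 normN.
have norm2_le (x : 'rV[R]_n.+1) : norm2 x <= n.+1%:R * `|x|.
  by apply: norm2_le_coord => // i; exact: coord_le_mx_norm.
have cN : continuous N.
  move=> x; apply/(@cvgrPdist_lt _ _ _ (nbhs x) (nbhs_filter x)) => e e0.
  apply/nbhs_ballP.
  exists (n.+1%:R^-1 * (K^-1 * e)); first by rewrite /= !mulr_gt0 ?invr_gt0.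
  move=> y /=; rewrite -ball_normE/= => xy.
  apply: (@le_lt_trans _ _ (N (x - y))).
    rewrite ler_norml; have := norm_le_dist normN x y.
    by have := norm_le_dist normN y x; rewrite (normBC normN y x); lra.
  apply: le_lt_trans (NK _) _; rewrite -ltr_pdivlMl//.
  by apply: le_lt_trans (norm2_le _) _; rewrite -ltr_pdivlMl.
pose S := [set x : 'rV[R]_n.+1 | `|x| = 1].
have S0 : S !=set0.
  exists (`|const_mx 1 : 'rV[R]_n.+1|^-1 *: const_mx 1); rewrite /S/= normrZ.
  rewrite ger0_norm ?invr_ge0// mulVf// normr_eq0; apply/eqP => /rowP/(_ ord0).
  by rewrite !mxE => /eqP; rewrite oner_eq0.
have cS : compact S.
  apply: bounded_closed_compact.
    by exists 1; split => // M M1 x /= ->; exact: ltW.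
  apply: (@closed_comp _ _ (fun x : 'rV[R]_n.+1 => `|x|) [set 1]) => //.
  by move=> x _; exact: norm_continuous.
have [u uS uN] := EVT_min_rV S0 cS (continuous_subspaceT cN).
have Nu0 : 0 < N u.
  apply: norm_gt0 => //; apply: contraTneq uS => ->.
  by apply/negP; rewrite inE /S/= normr0 => /esym/eqP; rewrite oner_eq0.
exists (N u / n.+1%:R); first by rewrite divr_gt0.
move=> x; have [->|x0] := eqVneq x 0; first by rewrite norm2_0 mulr0 norm0.
have nx0 : 0 < `|x| by rewrite normr_gt0.
apply: (@le_trans _ _ (N u * `|x|)).
  by rewrite -mulrA ler_pM2l// ler_pdivrMl.
have : N u <= N (`|x|^-1 *: x).
  by apply: uN; rewrite inE /S/= normrZ ger0_norm ?invr_ge0// mulVf ?gt_eqF.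
by rewrite (is_normZ normN) ger0_norm ?invr_ge0// ler_pdivlMl// mulrC.
Qed.

(** * Carathéodory measurability of balls *)

Section ball_measurable.
Context {R : realType} {m : nat} (N : 'rV[R]_m.+1 -> R).
Hypothesis normN : is_norm N.
Local Notation H := (hausdorff (norm_dist (@norm2 R m.+1)) m.+1).

Definition sublevel (r : R) : set 'rV[R]_m.+1 := [set y | N y <= r].

Lemma hsd_dilate_sublevel (a r : R) : 0 < a ->
  H (sublevel (a * r)) = ((a ^+ m.+1)%:E * H (sublevel r))%E.
Proof.
move=> a0; rewrite -hsd_scale//; congr hausdorff.
apply/seteqP; split => [y yr|_ [y yr <-]]; rewrite /sublevel/=; move: yr; rewrite /sublevel/= => yr.
  exists (a^-1 *: y); last by rewrite scalerA divff ?gt_eqF// scale1r.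
  by rewrite (is_normZ normN) gtr0_norm ?invr_gt0// ler_pdivrMl.
by rewrite (is_normZ normN) gtr0_norm// ler_pM2l.
Qed.

Lemma sublevel_sub_cube (r : R) : exists2 M, 0 < M &
  sublevel r `<=` cube (const_mx (- M)) (2 * M).
Proof.
have [c c0 cN] := norm_ge_norm2 normN.
exists (`|r| / c + 1); first by rewrite ltr_wpDl// divr_ge0// ltW.
move=> y yr i; rewrite mxE.
have : `|y 0 i| <= `|r| / c.
  apply: le_trans (coord_le_norm2 _ _) _; rewrite ler_pdivlMr// mulrC.
  by apply: le_trans (cN _) _; apply: le_trans yr _; exact: ler_norm.
by rewrite ler_norml; lra.
Qed.

Lemma hsd_bounded_fin (r : R) (X : set 'rV[R]_m.+1) :
  X `<=` sublevel r -> H X \is a fin_num.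
Proof.
move=> Xr; have [M M0 rM] := sublevel_sub_cube r.
rewrite ge0_fin_numE; last by apply: hausdorff_ge0; exact: norm_dist2_xx.
apply: (@le_lt_trans _ _ (H (cube (const_mx (- M)) (2 * M)))).
  apply: le_hausdorff.
  exact: subset_trans rM.
by rewrite hsd_cube ?mulr_gt0// cube_measureE -EFinM ltry.

Qed.

Lemma hsd_separated (X Y : set 'rV[R]_m.+1) (eta : R) : 0 < eta ->
  (forall x y, X x -> Y y -> eta <= N y - N x) ->
  (H X + H Y <= H (X `|` Y))%E.
Proof.
move=> eta0 XY; have [K K0 NK] := norm_le_norm2 normN.
apply: (@hausdorff_separated _ _ _ _ (@norm_dist2_xx R m.+1) X Y (eta / K)).
  by rewrite divr_gt0.
move=> x y Xx Yy; rewrite ler_pdivrMr// mulrC; apply: le_trans (NK _).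
apply: le_trans (XY _ _ Xx Yy) _; rewrite lerBlDl (normBC normN).
exact: norm_le_dist.
Qed.

Definition shell (r s : R) : set 'rV[R]_m.+1 := [set y | r < N y <= s].

Lemma hsd_dilate_shell (a r s : R) : 0 < a ->
  H (shell (a * r) (a * s)) = ((a ^+ m.+1)%:E * H (shell r s))%E.
Proof.
move=> a0; rewrite -hsd_scale//; congr hausdorff.
apply/seteqP; split => [y yr|_ [y yr <-]]; rewrite /shell/=; move: yr; rewrite /shell/= => yr.
  exists (a^-1 *: y); last by rewrite scalerA divff ?gt_eqF// scale1r.
  by rewrite (is_normZ normN) gtr0_norm ?invr_gt0// ler_pdivrMl// ltr_pdivlMl.
by rewrite (is_normZ normN) gtr0_norm// ler_pM2l// ltr_pM2l.
Qed.

(** The shells a^(2j) < N <= a^(2j+1) for j < k are dilates of the shell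
    1 < N <= a by factors at least 1, and the gaps between them keep them at
    positive distance, so their measures add up. *)
Lemma shells_fit (a : R) (k : nat) : 1 < a ->
  (k%:R%:E * H (shell 1 a) <= H [set y | ((1 < N y) && (a * N y <= a ^+ k.*2))%R])%E.
Proof.
move=> a1; have a0 : 0 < a by exact: lt_trans a1.
have dxx := @norm_dist2_xx R m.+1.
elim: k => [|k IH].
  by rewrite mul0e hausdorff_ge0.
have -> : (k.+1%:R%:E * H (shell 1 a) = k%:R%:E * H (shell 1 a) + H (shell 1 a))%E.
  by rewrite -natr1 EFinD ge0_muleDl ?mul1e ?lee_fin.
apply: (@le_trans _ _ (H [set y | ((1 < N y) && (a * N y <= a ^+ k.*2))%R] +
    H (shell (a ^+ k.*2 * 1)%R (a ^+ k.*2 * a)%R))%E).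
  apply: leeD => //; rewrite hsd_dilate_shell ?exprn_gt0//.
  rewrite -[leLHS]mul1e; apply: lee_wpmul2r; first exact: hausdorff_ge0.
  by rewrite lee_fin -exprM exprn_ege1// ltW.
apply: (@le_trans _ _ (H ([set y | ((1 < N y) && (a * N y <= a ^+ k.*2))%R] `|`
    shell (a ^+ k.*2 * 1)%R (a ^+ k.*2 * a)%R))).
  apply: (@hsd_separated _ _ (a - 1)); first by rewrite subr_gt0.
  move=> x y /= /andP[x1 xk] /andP[yk _]; rewrite mulr1 in yk.
  have : (a - 1) * 1 <= (a - 1) * N x by rewrite ler_pM2l ?subr_gt0// ltW.
  lra.
apply: le_hausdorff => //= y.
have ak1 : 1 <= a ^+ k.*2 by rewrite exprn_ege1// ltW.
rewrite doubleS !exprS /shell/= => -[/andP[y1 yk]|/andP[yk yk1]].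
  rewrite y1/=; apply: (le_trans yk); rewrite mulrA; apply: ler_peMl.
    by rewrite exprn_ge0// ltW.
  by rewrite -expr2 exprn_ege1// ltW.
by move: yk; rewrite mulr1 => /(le_lt_trans ak1) ->/=; rewrite ler_pM2l// mulrC.
Qed.

Lemma root_of_two (k : nat) : exists2 a : R, 1 < a & a ^+ k.+1 = 2.
Proof.
have E : (2 `^ (k.+1%:R^-1)) ^+ k.+1 = 2 :> R.
  by rewrite -powR_mulrn ?powR_ge0// -powRrM mulVf// powRr1.
exists (2 `^ (k.+1%:R^-1)) => //; rewrite ltNge; apply/negP => h.
have : (2 `^ (k.+1%:R^-1)) ^+ k.+1 <= 1 :> R by rewrite exprn_ile1// powR_ge0.
by rewrite E => ?; lra.
Qed.

(** Many dilates of a thin shell fit, at positive mutual distances, into a ball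
    of at most twice the measure of the unit ball. *)
Lemma thin_shell (e : R) : 0 < e -> exists2 a : R, 1 < a & (H (shell 1 a) <= e%:E)%E.
Proof.
move=> e0; have dxx := @norm_dist2_xx R m.+1.
have bfin : H (sublevel 1) \is a fin_num by exact: (@hsd_bounded_fin 1).
pose b := fine (H (sublevel 1)).
have b0 : 0 <= b by rewrite fine_ge0// hausdorff_ge0.
pose k := (Num.truncn (2 * b / e)).+1.
have kb : 2 * b / e < k%:R.
  have be0 : 0 <= 2 * b / e by rewrite divr_ge0 ?mulr_ge0// ltW.
  by have /andP[] := truncn_itv be0.
have [a a1 aE] := root_of_two (k.*2 * m.+1).-1.
rewrite prednK in aE; last by rewrite muln_gt0.
have a0 : 0 < a by exact: lt_trans a1.
exists a => //.
have sfin : H (shell 1 a) \is a fin_num.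
  by apply: (@hsd_bounded_fin a) => y; rewrite /shell /sublevel /= => /andP[].
have : (k%:R%:E * H (shell 1 a) <= (2 * b)%:E)%E.
  apply: le_trans (shells_fit k a1) _.
  apply: (@le_trans _ _ (H (sublevel (a ^+ k.*2 * 1)))).
    apply: le_hausdorff => //= y /andP[_ yk]; rewrite /sublevel/= mulr1.
    by apply: le_trans yk; rewrite ler_peMl ?norm_ge0// ltW.
  by rewrite hsd_dilate_sublevel ?exprn_gt0// -exprM aE EFinM fineK.
rewrite -(fineK sfin) -EFinM !lee_fin.
move: kb; rewrite ltr_pdivrMr// => kb h.
have : k%:R * fine (H (shell 1 a)) <= k%:R * e by exact: le_trans (ltW kb).
by rewrite ler_pM2l ?ltr0n.
Qed.

Lemma ball_caratheodory0 (X : set 'rV[R]_m.+1) :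
  (H (X `&` sublevel 1) + H (X `\` sublevel 1) <= H X)%E.
Proof.
have dxx := @norm_dist2_xx R m.+1.
apply/lee_addgt0Pr => e e0; have [a a1 ae] := thin_shell e0.
apply: (@le_trans _ _ (H (X `&` sublevel 1) + H (X `\` sublevel a) + H (shell 1 a))%E).
  rewrite -addeA; apply: leeD => //; apply: (le_trans _ (hausdorffU _ dxx _ _)).
  apply: le_hausdorff => //= y [Xy yB]; rewrite /sublevel/shell/=.
  have [ya|ya] := leP (N y) a; last by left; split => //; apply/negP; rewrite -ltNge.
  by right; rewrite andbT ltNge; apply/negP.
apply: leeD => //.
apply: (@le_trans _ _ (H ((X `&` sublevel 1) `|` (X `\` sublevel a)))).
  apply: (@hsd_separated _ _ (a - 1)); first by rewrite subr_gt0.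
  move=> x y [_ x1] [_ /negP]; rewrite -ltNge /sublevel/= in x1 * => ya.
  lra.
by apply: le_hausdorff => // y [[]|[]].
Qed.

Definition nball (v : 'rV[R]_m.+1) : set 'rV[R]_m.+1 := [set y | N (y - v) <= 1].

(** Carathéodory measurability of the balls: the thin shell between two nearby
    concentric balls separates the inside from the outside at small cost. *)
Lemma ball_caratheodory v (X : set 'rV[R]_m.+1) :
  H X = (H (X `&` nball v) + H (X `\` nball v))%E.
Proof.
have dxx := @norm_dist2_xx R m.+1.
apply/eqP; rewrite eq_le; apply/andP; split.
  apply: (le_trans _ (hausdorffU _ dxx _ _)); apply: le_hausdorff => // y Xy.
  by have [yv|yv] := pselect (nball v y); [left|right].
have := ball_caratheodory0 ((fun y => y - v) @` X).
rewrite -[X in (_ <= X)%E -> _](hsd_translate _ v) image_comp.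
rewrite (_ : _ \o _ = id); last by apply/funext => y /=; rewrite subrK.
rewrite image_id; apply: le_trans.
rewrite -[H (X `&` _)](hsd_translate _ (- v)) -[H (X `\` _)](hsd_translate _ (- v)).
by apply: leeD; apply: le_hausdorff => //= _ [y [Xy yv] <-]; split => //; exists y.
Qed.

End ball_measurable.

(** * Reflections *)

Section dot_theory.
Context {R : realType} {n : nat}.
Implicit Types v w x y z : 'rV[R]_n.

Lemma dotC x y : dot x y = dot y x.
Proof. by apply: eq_bigr => i _; rewrite mulrC. Qed.

Lemma dotDl x y z : dot (x + y) z = dot x z + dot y z.
Proof. by rewrite /dot -big_split; apply: eq_bigr => i _; rewrite mxE mulrDl. Qed.

Lemma dotZl a x z : dot (a *: x) z = a * dot x z.
Proof. by rewrite /dot mulr_sumr; apply: eq_bigr => i _; rewrite mxE mulrA. Qed.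

Lemma dotBl x y z : dot (x - y) z = dot x z - dot y z.
Proof. by rewrite dotDl -scaleN1r dotZl mulN1r. Qed.

Lemma dotBB x y : dot (x - y) (x - y) = dot x x - dot x y *+ 2 + dot y y.
Proof.
rewrite dotBl [dot x (x - y)]dotC [dot y (x - y)]dotC !dotBl [dot y x]dotC.
by rewrite mulr2n; ring.
Qed.

(** Reflection in the hyperplane orthogonal to v, and the identity if v = 0, as 0^-1 = 0. *)
Definition reflection (v x : 'rV[R]_n) := x - (2 * dot x v / dot v v) *: v.

Lemma dot_xx_eq0 v : dot v v = 0 -> v = 0.
Proof. by rewrite -sqr_norm2 => /eqP; rewrite sqrf_eq0 => /eqP; exact: norm2_eq0. Qed.

Lemma reflectionD v x y : reflection v (x + y) = reflection v x + reflection v y.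
Proof.
rewrite /reflection dotDl mulrDr mulrDl scalerDl opprD addrACA; congr (_ + _).
Qed.

Lemma reflectionZ v a x : reflection v (a *: x) = a *: reflection v x.
Proof. by rewrite /reflection dotZl scalerBr scalerA !mulrA [2 * a]mulrC. Qed.

Lemma reflectionB v x y : reflection v (x - y) = reflection v x - reflection v y.
Proof. by rewrite -scaleN1r reflectionD reflectionZ scaleN1r. Qed.

Lemma reflectionK v : involutive (reflection v).
Proof.
move=> x; rewrite {1}/reflection; have [v0|v0] := eqVneq (dot v v) 0.
  by rewrite (dot_xx_eq0 v0) /reflection !scaler0 !subr0.
have -> : reflection v x = x - (2 * dot x v / dot v v) *: v by [].
rewrite dotBl dotZl -addrA -opprD -scalerDl.
have -> : 2 * dot x v / dot v v + 2 * (dot x v - 2 * dot x v / dot v v * dot v v) /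
    dot v v = 0 by field.
by rewrite scale0r subr0.
Qed.

Lemma norm2_reflection v x : norm2 (reflection v x) = norm2 x.
Proof.
rewrite /norm2; congr Num.sqrt; rewrite /reflection dotBB dotZ [dot x (_ *: _)]dotC.
rewrite dotZl [dot v x]dotC; have [v0|v0] := eqVneq (dot v v) 0.
  by rewrite v0 invr0 !mulr0 mul0r mul0rn subr0 addr0.
by rewrite mulr2n; field.
Qed.

End dot_theory.

Lemma reflection_to_axis (R : realType) (m : nat) (w : 'rV[R]_m.+1) :
  let e := delta_mx 0 ord0 in
  reflection (norm2 w *: e - w) w = norm2 w *: e.
Proof.
move=> e; set v := _ - w.
have dee : dot e e = 1.
  rewrite /dot (bigD1 ord0)//= big1 ?addr0 ?mxE ?eqxx ?mulr1// => i i0.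
  by rewrite !mxE (negbTE i0) andbF mulr0.
have dvv : dot v v = - (2 * dot w v).
  rewrite {1}/v dotBB dotZ dee -sqr_norm2 [dot w v]dotC /v dotBl -sqr_norm2.
  by rewrite mulr2n; ring.
rewrite /reflection; have [v0|v0] := eqVneq (dot v v) 0.
  by rewrite (dot_xx_eq0 v0) scaler0 subr0; apply/esym/eqP; rewrite -subr_eq0 -/v (dot_xx_eq0 v0).
have -> : 2 * dot w v / dot v v = -1 by rewrite -[2 * _]opprK -dvv mulNr divff.
by rewrite scaleN1r opprK /v addrC subrK.
Qed.

Definition tailrow {R : realType} {m : nat} (y : 'rV[R]_m.+1) : 'rV[R]_m :=
  \row_j y 0 (lift ord0 j).

Lemma norm2_tailrow_le (R : realType) (m : nat) (x y : 'rV[R]_m.+1) :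
  norm2 (tailrow x - tailrow y) <= norm2 (x - y).
Proof.
apply: ler_wsqrtr; rewrite /dot [leRHS]big_ord_recl -[leLHS]add0r; apply: lerD.
  by rewrite -expr2 sqr_ge0.
by apply: ler_sum => i _; rewrite !mxE.
Qed.

(** * Volume of cylinders *)

Section cylinder.
Context {R : realType} {m : nat}.

(** Fubini for a cylinder, with room to spare in the base. In a fine grid, the
    cells that meet Q are inside P, and they are enough to tile the cylinder
    over Q; on the other hand the measure of P is at least that of the cells
    inside it, since the remaining cells cannot fill the whole box. *)
Lemma hsd_cylinder_grid (P Q : set 'rV[R]_m) (M a e : R) (K J : nat) :
  0 < e -> (0 < K)%N -> (0 < J)%N -> 2 * M = K%:R * e ->
  P `<=` cube (const_mx (- M)) (2 * M) ->
  (forall x u : 'rV[R]_m, Q x -> (forall i, `|u 0 i - x 0 i| <= e) -> P u) ->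
  (hsd m.+1 [set y : 'rV[R]_m.+1 | (a <= y 0 ord0 <= a + J%:R * e)%R /\ Q (tailrow y)] <=
    (J%:R * e * (@cube_measure R m.+1 / @cube_measure R m))%:E * hsd m P)%E.
Proof.
move=> e0 K0 J0 MKe Pbox QP.
pose c := const_mx (- M) : 'rV[R]_m.
pose inner := [pred p : {ffun 'I_m -> 'I_K} | `[< subcube c e p `<=` P >]].
have cellH (p : {ffun 'I_m -> 'I_K}) :
    (hsd m (subcube c e p) <= (e ^+ m * @cube_measure R m)%:E)%E.
  by rewrite /subcube hsd_cube// cube_measureE EFinM.
(* All K^m cells together have the measure of the box, which is covered by P
   and the cells that are not inside P. *)
have innerP : ((#|inner|%:R * (e ^+ m * @cube_measure R m))%:E <= hsd m P)%E.
  have : (hsd m (cube c (2 * M)) <= hsd m P +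
      (#|predC inner|%:R * (e ^+ m * @cube_measure R m))%:E)%E.
    apply: (@le_trans _ _ (hsd m P + hsd m (\bigcup_(p in [set` predC inner])
        subcube c e p))%E).
      apply: (le_trans _ (hausdorffU _ (@norm_dist2_xx R m) _ _)).
      apply: le_hausdorff => x; rewrite MKe => /(subcube_cover e0 K0)[p _ xp].
      have [pin|pout] := boolP (p \in inner); last by right; exists p.
      have /asboolP pP : `[< subcube c e p `<=` P >] := pin.
      by left; exact: pP.
    apply: leeD => //; apply: hausdorff_cover => //; first exact: norm_dist2_xx.
    by move=> x [p pout xp]; exists p.
  rewrite hsd_cube ?MKe ?mulr_gt0 ?ltr0n// cube_measureE -EFinM.
  rewrite -leeBlDr//; apply: le_trans; rewrite -EFinB lee_fin.
  rewrite lerBrDr -mulrDl -natrD cardC card_cells exprMn natrX.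
  by rewrite mulrA.
pose cells : {pred 'I_J * {ffun 'I_m -> 'I_K}} := [predX predT & inner].
pose box (jp : 'I_J * {ffun 'I_m -> 'I_K}) : set 'rV[R]_m.+1 :=
  cube (consrow (a + jp.1%:R * e) (c + e *: \row_i ((jp.2 i)%:R : R))) e.
apply: (@le_trans _ _ (#|cells|%:R * (e ^+ m.+1 * @cube_measure R m.+1))%:E).
  apply: (@hausdorff_cover _ _ _ _ _ _ cells box).
  - exact: norm_dist2_xx.
  - move=> y [/andP[ya yJ] Qy].
    have [|p _ yp] := @subcube_cover _ _ c e K e0 K0 (tailrow y).
      by rewrite -MKe; apply: Pbox; apply: QP Qy _ => i; rewrite subrr normr0 ltW.
    have [|//|j jP] := @cell_index _ J ((y 0 ord0 - a) / e).
      by rewrite divr_ge0 ?subr_ge0 ?(ltW e0)//= ler_pdivrMr// lerBlDl.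
    exists (j, p).
      apply/andP; split => //; apply/asboolP => u up; apply: QP Qy _ => i.
      have := up i; have := yp i; rewrite ler_norml; lra.
    move=> i; case: (unliftP ord0 i) => [k ->|->].
      by rewrite consrowS /=; have := yp k; rewrite [X in _ <= X <= _ -> _]mxE.
    rewrite consrow0 /=; move/andP: jP.
    by rewrite ler_pdivlMr// ler_pdivrMr// mulrDl mul1r; lra.
  - by move=> [j p] _; rewrite /box hsd_cube// cube_measureE EFinM.
have -> : #|cells| = (J * #|inner|)%N by rewrite /cells cardX card_ord.
have h0 := @cube_measure_gt0 R m; have h1 := @cube_measure_gt0 R m.+1.
have -> : ((J * #|inner|)%:R * (e ^+ m.+1 * @cube_measure R m.+1))%:E =
    ((J%:R * e * (@cube_measure R m.+1 / @cube_measure R m))%:E *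
     (#|inner|%:R * (e ^+ m * @cube_measure R m))%:E)%E.
  by rewrite -EFinM; congr EFin; rewrite natrM exprS; field; rewrite gt_eqF.
apply: lee_wpmul2l => //; rewrite lee_fin; apply: mulr_ge0.
  by rewrite mulr_ge0// ltW.
by rewrite divr_ge0// ltW.
Qed.

End cylinder.

(** * Translating a convex body along a line *)

Lemma slope_le (R : realType) (A B c : R) :
  (forall k : nat, k%:R * c <= A + k%:R * B) -> c <= B.
Proof.
move=> h; rewrite leNgt; apply/negP => Bc.
have cB0 : 0 < c - B by rewrite subr_gt0.
pose k := (Num.truncn (`|A| / (c - B))).+1.
have A0 : 0 <= `|A| / (c - B) by rewrite divr_ge0// ltW.
have /andP[_] := truncn_itv A0; rewrite -/k ltr_pdivrMr// => kA.
have := h k; have := ler_norm A; lra.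
Qed.

Section sweep.
Context {R : realType} {m : nat} (N : 'rV[R]_m.+1 -> R).
Hypothesis normN : is_norm N.
Local Notation H := (hausdorff (norm_dist (@norm2 R m.+1)) m.+1).

Definition sweep (v : 'rV[R]_m.+1) (k : nat) : set 'rV[R]_m.+1 :=
  [set y | ~ nball N 0 y /\ exists2 j : nat, (1 <= j <= k)%N & nball N (j%:R *: v) y].

(** By convexity, the part of a sweep outside the first translate contains a
    translated copy of the sweep that is shorter by one. *)
Lemma sweep_step v k : (H (nball N v `\` nball N 0) + H (sweep v k) <= H (sweep v k.+1))%E.
Proof.
rewrite [leRHS](ball_caratheodory normN v); apply: leeD.
  apply: le_hausdorff => y [yv y0]; split => //; split => //.
  by exists 1%N => //; rewrite scale1r.
rewrite -[leLHS](hsd_translate _ v); apply: le_hausdorff.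
move=> _ [x [x0 [j /andP[j1 jk] xj]] <-].
have xv : ~ nball N v (x + v) by move: x0; rewrite /nball/= addrK subr0.
have xj' : nball N (j.+1%:R *: v) (x + v).
  by move: xj; rewrite /nball/= -natr1 scalerDl scale1r opprD addrACA subrr addr0.
split => //; split; last by exists j.+1.
rewrite /nball/= subr0 => xv0; apply: xv; rewrite /nball/=.
have j0 : 0 < j.+1%:R :> R by rewrite ltr0n.
have jE : j%:R / j.+1%:R + j.+1%:R^-1 = 1 :> R.
  by rewrite -{1}(addrK 1 j%:R) natr1 mulrBl divff ?gt_eqF// mul1r subrK.
(* The point x + v lies in the balls centred at 0 and at (j+1) v, hence in the
   one centred at the point v between them. *)
have -> : x + v - v = (j%:R / j.+1%:R) *: (x + v) +
    j.+1%:R^-1 *: (x + v - j.+1%:R *: v).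
  rewrite scalerBr [_^-1 *: (_ *: v)]scalerA mulVf ?gt_eqF// scale1r addrA -scalerDl.
  by rewrite jE scale1r.
apply: le_trans (is_normD normN _ _) _; rewrite !(is_normZ normN).
rewrite !ger0_norm ?divr_ge0 ?invr_ge0 ?ler0n//.
apply: (@le_trans _ _ (j%:R / j.+1%:R * 1 + j.+1%:R^-1 * 1)).
  by apply: lerD; apply: ler_wpM2l; rewrite ?divr_ge0 ?invr_ge0.
by rewrite !mulr1 jE.
Qed.

Lemma sweep_ge v k : (k%:R%:E * H (nball N v `\` nball N 0) <= H (sweep v k))%E.
Proof.
have H0 X : (0 <= H X)%E by apply: hausdorff_ge0; exact: norm_dist2_xx.
elim: k => [|k IH]; first by rewrite mul0e.
apply: le_trans (sweep_step v k).
rewrite -nat1r EFinD ge0_muleDl ?lee_fin// mul1e; exact: leeD.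
Qed.

(** The union of k translates along the first axis lies in a cylinder over P
    of height k t + O(1), and contains k disjoint pieces that have the measure
    of the difference set; let k tend to infinity. *)
Lemma hsd_axis_translate_diff (P : set 'rV[R]_m) (M eta t : R) :
  0 < t -> 0 < eta -> 0 < M -> P `<=` cube (const_mx (- M)) (2 * M) ->
  (forall (x : 'rV[R]_m.+1) (u : 'rV[R]_m), N x <= 1 ->
    (forall i, `|u 0 i - tailrow x 0 i| <= eta) -> P u) ->
  (H (nball N (t *: delta_mx 0 ord0)%R `\` nball N 0) <=
    (t * (@cube_measure R m.+1 / @cube_measure R m))%:E * hsd m P)%E.
Proof.
move=> t0 eta0 M0 Pbox NP.
set v := t *: delta_mx 0 ord0.
have h0 := @cube_measure_gt0 R m; have h1 := @cube_measure_gt0 R m.+1.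
have c0 : 0 < @cube_measure R m.+1 / @cube_measure R m by rewrite divr_gt0.
set c := @cube_measure R m.+1 / @cube_measure R m in c0 *.
have P0 : (0 <= hsd m P)%E by apply: hausdorff_ge0; exact: norm_dist2_xx.
have [Poo|Pfin] := eqVneq (hsd m P) +oo%E.
  by rewrite Poo gt0_muley ?leey// lte_fin mulr_gt0.
have {}Pfin : hsd m P \is a fin_num by rewrite ge0_fin_numE// ltey.
pose p := fine (hsd m P).
have p0 : 0 <= p by rewrite fine_ge0.
have [M1 M10 NM1] := sublevel_sub_cube normN 1.
(* The mesh e = 2 M / K is at most eta and divides the side of the box. *)
pose K := (Num.truncn (2 * M / eta)).+1.
have K0 : 0 < K%:R :> R by rewrite ltr0n.
have MK : 2 * M < K%:R * eta.
  have M0' : 0 <= 2 * M / eta by rewrite divr_ge0 ?mulr_ge0// ltW.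
  by have /andP[_] := truncn_itv M0'; rewrite -/K ltr_pdivrMr.
pose e := 2 * M / K%:R.
have e0 : 0 < e by rewrite divr_gt0// mulr_gt0.
have eeta : e <= eta by rewrite ler_pdivrMr// [leRHS]mulrC ltW.
pose Q : set 'rV[R]_m := [set tailrow x | x in [set x | N x <= 1]].
have dfin : H (nball N v `\` nball N 0) \is a fin_num.
  apply: (@hsd_bounded_fin _ _ _ normN (1 + N v)) => y [yv _].
  apply: le_trans (norm_le_dist normN y v) _; rewrite addrC lerD2r//.
rewrite -(fineK dfin) -(fineK Pfin) -/p -EFinM lee_fin.
apply: (@slope_le _ ((2 * M1 + e) * c * p)) => k.
pose J := (Num.truncn ((2 * M1 + k%:R * t) / e)).+1.
have L0 : 0 <= (2 * M1 + k%:R * t) / e.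
  by rewrite divr_ge0 ?addr_ge0 ?mulr_ge0// ltW.
have /andP[J1 J2] := truncn_itv L0.
have J1' : (2 * M1 + k%:R * t) <= J%:R * e.
  by move: J2; rewrite -/J ltr_pdivrMr// => /ltW.
have J2' : J%:R * e <= 2 * M1 + k%:R * t + e.
  by move: J1; rewrite ler_pdivlMr// => J1; rewrite /J -natr1 mulrDl mul1r lerD2r.
have cyl : (H (sweep v k) <= (J%:R * e * c)%:E * hsd m P)%E.
  apply: le_trans (@hsd_cylinder_grid _ _ P Q M (- M1) e K J e0 _ _ _ Pbox _) => //.
  - apply: le_hausdorff => y [_ [j /andP[j1 jk] yj]].
    have /= yE := NM1 _ yj.
    split.
      have := yE ord0; rewrite !mxE !eqxx mulr1 => /andP[y1 y2].
      have jt0 : 0 <= j%:R * t by rewrite mulr_ge0// ltW.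
      have jtk : j%:R * t <= k%:R * t by rewrite ler_pM2r// ler_nat.
      by apply/andP; split; lra.
    exists (y - j%:R *: v) => //; apply/rowP => i; rewrite !mxE.
    by rewrite eq_sym (negbTE (neq_lift _ _)) andbF !mulr0 subr0.
  - by rewrite /e [RHS]mulrC mulfVK// gt_eqF.
  - move=> _ u [x Nx <-] ux; apply: NP Nx _ => i.
    exact: le_trans (ux i) eeta.
have := le_trans (sweep_ge v k) cyl.
rewrite -(fineK dfin) -(fineK Pfin) -/p -!EFinM lee_fin => kJ.
apply: (le_trans kJ).
apply: (@le_trans _ _ ((2 * M1 + k%:R * t + e) * (c * p))).
  by rewrite -[leLHS]mulrA ler_wpM2r// mulr_ge0// ltW.
by rewrite le_eqVlt; apply/orP; left; apply/eqP; ring.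
Qed.

End sweep.

Section translate_diff.
Context {R : realType} {m : nat} (N : 'rV[R]_m.+1 -> R).
Hypothesis normN : is_norm N.
Local Notation H := (hausdorff (norm_dist (@norm2 R m.+1)) m.+1).

Lemma is_norm_reflection v : is_norm (N \o reflection v).
Proof.
split => [x /= /(is_norm_eq0 normN) x0|a x|x y] /=.
- by rewrite -[x](reflectionK v) x0 /reflection /dot big1 ?mulr0 ?mul0r ?scale0r ?subr0// => i _; rewrite mxE mul0r.
- by rewrite reflectionZ (is_normZ normN).
- by rewrite reflectionD; exact: is_normD.
Qed.

Lemma bernoulli_half : (1 / 2 : R) <= (1 - (m.+1%:R *+ 2)^-1) ^+ m.
Proof.
set a := (m.+1%:R *+ 2)^-1.
have a0 : 0 <= a by rewrite invr_ge0 mulrn_wge0.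
have am : m.+1%:R * a = 1 / 2.
  by rewrite /a -(mulr_natr _ 2) invfM mulrA divff ?pnatr_eq0// mul1r div1r.
have a1 : a <= 1 / 2 by rewrite -am ler_peMl// ler1n.
suff h k : 1 - k%:R * a <= (1 - a) ^+ k.
  apply: le_trans (h m); rewrite -[m%:R](addrK 1) natr1 mulrBl am; lra.
elim: k => [|k IH]; first by rewrite mul0r subr0 expr0.
rewrite exprS; apply: (@le_trans _ _ ((1 - a) * (1 - k%:R * a))).
  have : 0 <= k%:R * a * a by rewrite !mulr_ge0.
  by rewrite -natr1; lra.
by rewrite ler_wpM2l// subr_ge0; lra.
Qed.

(** Reflect w to the first axis. The balls are shrunk by a factor whose m-th
    power is still at least 1/2, so that their shadow has room inside that of
    the unit ball. *)
Lemma hsd_translate_diff (w : 'rV[R]_m.+1) : w != 0 ->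
  (H (nball N w `\` nball N 0) <=
    (2 * norm2 w * (@cube_measure R m.+1 / @cube_measure R m))%:E *
    hsd m (proj_perp w @` unit_ball N))%E.
Proof.
move=> w0; set rho := reflection (norm2 w *: delta_mx 0 ord0 - w).
have w_gt0 : 0 < norm2 w.
  by rewrite lt_neqAle norm2_ge0 andbT eq_sym; apply: contra_neq w0; exact: norm2_eq0.
have rhow : rho w = norm2 w *: delta_mx 0 ord0 by exact: reflection_to_axis.
have rhoK : involutive rho by exact: reflectionK.
set k := 1 - (m.+1%:R *+ 2)^-1 : R.
have k1 : k < 1 by rewrite ltrBlDr ltrDl invr_gt0 pmulrn_rgt0.
have k0 : 0 < k.
  rewrite subr_gt0 invf_lt1 ?pmulrn_rgt0// -(mulr_natr _ 2).
  have : 1 <= m.+1%:R :> R by rewrite ler1n.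
  lra.
pose N0 := N \o rho; have normN0 : is_norm N0 by exact: is_norm_reflection.
pose N1 x := k^-1 * N0 x.
(* N1 has the reflected ball shrunk by k as its unit ball. *)
have normN1 : is_norm N1.
  split => [x /eqP|b x|x y].
  - by rewrite mulf_eq0 invr_eq0 gt_eqF//= => /eqP; exact: is_norm_eq0.
  - by rewrite /N1 (is_normZ normN0); ring.
  - by rewrite -mulrDr ler_pM2l ?invr_gt0//; exact: is_normD.
have [K K0 NK] := norm_le_norm2 normN0.
have [M M0 N0M] := sublevel_sub_cube normN0 1.
pose P : set 'rV[R]_m := tailrow @` sublevel N0 1.
have Pbox : P `<=` cube (const_mx (- M)) (2 * M).
  by move=> _ [x x1 <-] i; have := N0M _ x1 (lift ord0 i); rewrite !mxE.
pose eta := (1 - k) / (K * m.+1%:R).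
have Km0 : 0 < K * m.+1%:R by rewrite mulr_gt0.
have eta0 : 0 < eta by rewrite divr_gt0// subr_gt0.
have NP (x : 'rV[R]_m.+1) (u : 'rV[R]_m) : N1 x <= 1 ->
    (forall i, `|u 0 i - tailrow x 0 i| <= eta) -> P u.
  rewrite /N1 ler_pdivrMl// mulr1 => xk ux.
  exists (consrow (x 0 ord0) u); last first.
    by apply/rowP => i; rewrite mxE consrowS.
  rewrite /sublevel/=; apply: le_trans (norm_le_dist normN0 _ x) _.
  have : N0 (consrow (x 0 ord0) u - x) <= K * (m.+1%:R * eta).
    apply: le_trans (NK _) _; rewrite ler_pM2l//.
    apply: norm2_le_coord => [|i]; first exact: ltW.
    rewrite !mxE; case: (unliftP ord0 i) => [j ->|->].
      by have := ux j; rewrite mxE.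
    by rewrite subrr normr0 ltW.
  rewrite mulrA /eta mulrC mulfVK ?gt_eqF//; lra.
have kw0 : 0 < k * norm2 w by rewrite mulr_gt0.
have diffE := hsd_axis_translate_diff normN1 kw0 eta0 M0 Pbox NP.
have h0 := @cube_measure_gt0 R m; have h1 := @cube_measure_gt0 R m.+1.
have c0 : 0 < @cube_measure R m.+1 / @cube_measure R m by rewrite divr_gt0.
set c := @cube_measure R m.+1 / @cube_measure R m in c0 diffE *.
have PP : (hsd m P <= hsd m (proj_perp w @` unit_ball N))%E.
  have -> : P = (tailrow \o rho) @` (proj_perp w @` unit_ball N).
    rewrite image_comp; apply/seteqP; split => [_ [x x1 <-]|_ [x x1 <-]] /=.
      exists (rho x) => //=; rewrite /proj_perp /rho reflectionB reflectionZ -/rho.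
      rewrite rhow rhoK; apply/rowP => i; rewrite !mxE.
      by rewrite eq_sym (negbTE (neq_lift _ _)) andbF !mulr0 subr0.
    exists (rho x); first by rewrite /sublevel /N0/= rhoK.
    rewrite /proj_perp /rho reflectionB reflectionZ -/rho.
    rewrite rhow; apply/rowP => i; rewrite !mxE.
    by rewrite eq_sym (negbTE (neq_lift _ _)) andbF !mulr0 subr0.
  apply: hsd_contraction => x y /=; apply: le_trans (norm2_tailrow_le _ _) _.
  by rewrite -reflectionB norm2_reflection.
set E := nball N w `\` nball N 0.
have kE : ((k ^+ m.+1)%:E * H E <= (k * norm2 w * c)%:E * hsd m P)%E.
  apply: le_trans diffE; rewrite -hsd_scale//.
  apply: (@le_trans _ _ (H (rho @` (rho @` ((fun x => k *: x) @` E))))).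
    rewrite image_comp (_ : _ \o _ = id) ?image_id//.
    by apply/funext => x /=; rewrite rhoK.
  apply: le_trans (hsd_contraction _ _ _) _.
    by move=> x y; rewrite -reflectionB norm2_reflection.
  apply: le_hausdorff => _ [_ [x [xw x0] <-] <-].
  have nk y : N1 (rho (k *: y)) = N y.
    rewrite /N1 /N0/= rhoK (is_normZ normN) gtr0_norm// mulrA mulVf ?mul1r//.
    by rewrite gt_eqF.
  split; rewrite /nball/=.
    by rewrite -scalerA -rhow -reflectionZ -reflectionB -scalerBr nk.
  by rewrite subr0 nk; move: x0; rewrite /nball/= subr0.
have P0 : (0 <= hsd m P)%E by apply: hausdorff_ge0; exact: norm_dist2_xx.
apply: (@le_trans _ _ ((2 * norm2 w * c)%:E * hsd m P)%E); last first.
  apply: lee_wpmul2l => //; rewrite lee_fin; apply: mulr_ge0; last exact: ltW.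
  by rewrite mulr_ge0// ltW.
rewrite -lee_pdivlMl ?exprn_gt0// in kE; apply: le_trans kE _.
rewrite muleA -EFinM; apply: lee_wpmul2r => //; rewrite lee_fin.
have km0 : 0 < k ^+ m by rewrite exprn_gt0.
have -> : (k ^+ m.+1)^-1 * (k * norm2 w * c) = (k ^+ m)^-1 * (norm2 w * c).
  by rewrite exprS; field; rewrite !gt_eqF.
rewrite -mulrA; apply: ler_wpM2r; first by rewrite mulr_ge0// ltW.
rewrite -[leRHS]invrK lef_pV2 ?posrE ?invr_gt0//.
by have := bernoulli_half; rewrite div1r.
Qed.

End translate_diff.

(** * Averages over balls *)

Section averages.
Context {R : realType} {m : nat} (N : 'rV[R]_m.+1 -> R).
Hypothesis normN : is_norm N.
Local Notation H := (hausdorff (norm_dist (@norm2 R m.+1)) m.+1).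

(** Hausdorff measure as a real number, meant for bounded sets. *)
Definition mu (X : set 'rV[R]_m.+1) : R := fine (H X).

Lemma le_mu (r : R) (X Y : set 'rV[R]_m.+1) : Y `<=` sublevel N r -> X `<=` Y ->
  mu X <= mu Y.
Proof.
move=> Yr XY; apply: fine_le; [..|exact: le_hausdorff].
  exact: (hsd_bounded_fin normN (subset_trans XY Yr)).
exact: (hsd_bounded_fin normN Yr).
Qed.

Lemma nball_sublevel v : nball N v `<=` sublevel N (1 + N v).
Proof.
move=> y yv; apply: le_trans (norm_le_dist normN y v) _.
by rewrite addrC lerD2r.
Qed.

Lemma mu_split (r : R) v (X : set 'rV[R]_m.+1) : X `<=` sublevel N r ->
  mu X = mu (X `&` nball N v) + mu (X `\` nball N v).
Proof.
move=> Xr; rewrite /mu (ball_caratheodory normN v X) fineD//.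
  by apply: (@hsd_bounded_fin _ _ _ normN r) => y [/Xr].
by apply: (@hsd_bounded_fin _ _ _ normN r) => y [/Xr].
Qed.

Lemma mu_translate w (X : set 'rV[R]_m.+1) : mu [set y | X (y - w)] = mu X.
Proof.
rewrite /mu -[H X](hsd_translate _ w); congr (fine (H _)).
apply/seteqP; split => [y Xy|_ [y Xy <-]] /=; last by rewrite addrK.
by exists (y - w) => //; rewrite subrK.
Qed.

Local Notation D := (nball N).
Definition ballmu : R := mu (D 0).

Lemma mu_nball u : mu (D u) = ballmu.
Proof.
rewrite /ballmu -[RHS](mu_translate u); congr mu.
by apply/seteqP; split => y; rewrite /nball/= subr0.
Qed.

Lemma ballmu_gt0 : 0 < ballmu.
Proof.
have [K K0 NK] := norm_le_norm2 normN.
pose e := (K * m.+1%:R)^-1.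
have e0 : 0 < e by rewrite invr_gt0 mulr_gt0.
have eD : cube 0 e `<=` D 0.
  move=> y y0; rewrite /nball/= subr0; apply: le_trans (NK _) _.
  rewrite -ler_pdivlMl// mulr1; apply: (@le_trans _ _ (m.+1%:R * e)).
    apply: norm2_le_coord => [|i]; first exact: ltW.
    by have := y0 i; rewrite mxE ler_norml; lra.
  by rewrite /e invfM mulrCA divff ?mulr1.
apply: lt_le_trans (le_mu (@nball_sublevel 0) eD).
by rewrite /mu hsd_cube// cube_measureE -EFinM/= mulr_gt0 ?exprn_gt0// cube_measure_gt0.
Qed.

(** The second set is a translate of D 0 minus D w, so this is the relative size
    of the symmetric difference of D 0 and D w. *)
Definition shift_cost (w : 'rV[R]_m.+1) : R :=
  (mu (D w `\` D 0) + mu (D (- w) `\` D 0)) / ballmu.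

Lemma mu_nballD u v : mu (D u `\` D v) = mu (D (u - v) `\` D 0).
Proof.
rewrite -[RHS](mu_translate v); congr mu; apply/seteqP.
by split => y; rewrite /nball/= subr0 opprB addrA subrK.
Qed.

Lemma shift_costE u v : mu (D u `\` D v) + mu (D v `\` D u) =
  shift_cost (u - v) * ballmu.
Proof.
have b0 : ballmu != 0 by rewrite gt_eqF// ballmu_gt0.
by rewrite (mu_nballD u v) (mu_nballD v u) /shift_cost opprB mulfVK.
Qed.

Lemma shift_costN w : shift_cost (- w) = shift_cost w.
Proof. by rewrite /shift_cost opprK addrC. Qed.

(** The ball and its translate are disjoint. *)
Lemma far_shift_cost w : 2 < N w -> shift_cost w = 2.
Proof.
move=> w2.
have DE v : 2 < N v -> D v `\` D 0 = D v.
  move=> v2; apply/seteqP; split => [y []//|y yv]; split => //.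
  rewrite /nball/= subr0 in yv * => y1.
  have := norm_le_dist normN v y; rewrite (normBC normN); lra.
rewrite /shift_cost !DE ?normNx// !mu_nball mulrDl divff ?gt_eqF//.
exact: ballmu_gt0.
Qed.

(** A cover of space by countably many pieces of diameter at most 1 of which
    finitely many cover any given ball. *)
Lemma locally_finite_cover : exists Q : nat -> set 'rV[R]_m.+1,
  (forall j x y, Q j x -> Q j y -> N (x - y) <= 1) /\
  (forall r, exists J : nat, forall x, N x <= r -> exists2 j, (j < J)%N & Q j x).
Proof.
have [K K0 NK] := norm_le_norm2 normN.
pose e := (K * m.+1%:R)^-1.
have e0 : 0 < e by rewrite invr_gt0 mulr_gt0.
pose I := {k : nat & {ffun 'I_m.+1 -> 'I_k}}.
pose cell (i : I) : set 'rV[R]_m.+1 :=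
  subcube (const_mx (- (tag i)%:R * e / 2)) e (tagged i).
(* The index (k, p) stands for cell p of the cube of side k e centred at the
   origin, so a bounded set meets only the finitely many indices of one k. *)
exists (fun j => if @unpickle I j is Some i then cell i else set0); split.
  move=> j x y; case: unpickle => // i xi yi.
  apply: le_trans (NK _) _; rewrite -ler_pdivlMl// mulr1.
  apply: (@le_trans _ _ (m.+1%:R * e)).
    apply: norm2_le_coord => [|k]; first exact: ltW.
    by have := xi k; have := yi k; rewrite !mxE ler_norml; lra.
  by rewrite /e invfM mulrCA divff ?mulr1.
move=> r; have [M M0 rM] := sublevel_sub_cube normN r.
pose k := (Num.truncn (2 * M / e)).+1.
have Me0 : 0 <= 2 * M / e by rewrite divr_ge0 ?mulr_ge0// ltW.
have Mk : 2 * M <= k%:R * e.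
  by have /andP[_] := truncn_itv Me0; rewrite -/k ltr_pdivrMr// => /ltW.
pose pk (p : {ffun 'I_m.+1 -> 'I_k}) := @pickle I (Tagged _ p).
exists (\max_p pk p).+1 => x xr.
have [//|p _ xp] := @subcube_cover _ _ (const_mx (- k%:R * e / 2)) e k e0 isT x.
  by move=> i; have := rM _ xr i; rewrite !mxE; lra.
exists (pk p); first by rewrite ltnS; exact: (leq_bigmax p).
by rewrite pickleK.
Qed.

End averages.

Lemma weighted_sum_diff (R : realType) (V : lmodType R) (J : nat) (s t : nat -> R)
    (g : nat -> V) (a : V) : \sum_(j < J) (s j - t j) = 0 ->
  \sum_(j < J) s j *: g j - \sum_(j < J) t j *: g j =
  \sum_(j < J) (s j - t j) *: (g j - a).
Proof.
move=> st0; under [RHS]eq_bigr do rewrite scalerBr.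
rewrite sumrB -scaler_suml st0 scale0r subr0 -sumrB.
by apply: eq_bigr => j _; rewrite scalerBl.
Qed.

Section weights.
Context {R : realType} {m : nat} (N : 'rV[R]_m.+1 -> R).
Hypothesis normN : is_norm N.
Local Notation D := (nball N).
Variable Q : nat -> set 'rV[R]_m.+1.

Definition initial (j : nat) : set 'rV[R]_m.+1 :=
  [set x | exists2 i, (i < j)%N & Q i x].

Lemma initialS j : initial j `<=` initial j.+1.
Proof. by move=> x [i ij Qx]; exists i => //; exact: ltnW. Qed.

(** Written as a difference because the pieces need not be measurable; for
    measurable ones it is the measure of the points of X whose first piece is
    the j-th one. *)
Definition share (X : set 'rV[R]_m.+1) (j : nat) : R :=
  mu (X `&` initial j.+1) - mu (X `&` initial j).

Lemma share_ge0 X r j : X `<=` sublevel N r -> 0 <= share X j.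
Proof.
move=> Xr; rewrite subr_ge0; apply: (@le_mu _ _ _ normN r).
  by move=> y [/Xr].
by move=> y [Xy yj]; split => //; exact: initialS.
Qed.

Lemma share_eq0 X j : ~ (exists2 y, X y & Q j y) -> share X j = 0.
Proof.
move=> XQ; apply/eqP; rewrite subr_eq0; apply/eqP; congr mu.
apply/seteqP; split => y [Xy yj]; split => //; last exact: initialS.
move: yj => [i]; rewrite ltnS leq_eqVlt => /orP[/eqP -> Qy|ij Qy]; last by exists i.
by case: XQ; exists y.
Qed.

Lemma share_sum X J : \sum_(j < J) share X j = mu (X `&` initial J).
Proof.
rewrite -(big_mkord xpredT (share X)) telescope_sumr//.
rewrite (_ : X `&` initial 0 = set0); last by apply/seteqP; split => // y [_ [i]].
by rewrite [X in _ - X]/mu hausdorff_set0 ?subr0//; exact: norm_dist2_xx.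
Qed.

Lemma share_sum_le X J r : X `<=` sublevel N r -> \sum_(j < J) share X j <= mu X.
Proof.
move=> Xr; rewrite share_sum; apply: (@le_mu _ _ _ normN r) => //; exact: subIsetl.
Qed.

(** By measurability of the ball D v. The first term is symmetric in u and v, so
    the shares of two balls differ by those of their parts outside each other. *)
Lemma share_split u v j : share (D u) j = share (D u `&` D v) j + share (D u `\` D v) j.
Proof.
have splitI i : mu (D u `&` initial i) =
    mu (D u `&` D v `&` initial i) + mu ((D u `\` D v) `&` initial i).
  rewrite (@mu_split _ _ _ normN (1 + N u) v); last first.
    by move=> y [/(nball_sublevel normN)].
  by congr (_ + _); congr mu; [rewrite setIAC|rewrite setDE setIAC -setDE].
rewrite /share !splitI; ring.
Qed.

Variables (Z : normedModType R).
Implicit Types (g : nat -> Z) (a : Z).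

(** The cut-off J is a parameter so that two points can be compared with the same
    one; any J such that the first J pieces cover the ball gives the same mean. *)
Definition average (J : nat) g u : Z :=
  (ballmu N)^-1 *: \sum_(j < J) share (D u) j *: g j.

Lemma average_stable J J' g u : (J <= J')%N -> D u `<=` initial J ->
  average J' g u = average J g u.
Proof.
move=> JJ' uJ; congr (_ *: _).
rewrite -(big_mkord xpredT (fun j => share (D u) j *: g j)) (big_cat_nat (n := J))//=.
rewrite big_mkord [X in _ + X]big1_seq ?addr0// => j /andP[_].
rewrite mem_index_iota => /andP[Jj _]; rewrite /share.
have uj k : (J <= k)%N -> D u `&` initial k = D u.
  move=> Jk; apply/setIidPl => y /uJ[i iJ Qy]; exists i => //.
  exact: leq_trans Jk.
by rewrite !uj ?subrr ?scale0r// leqW.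
Qed.

Lemma average_near J g u a (rho : R) : D u `<=` initial J ->
  (forall j y, D u y -> Q j y -> `|g j - a| <= rho) -> `|average J g u - a| <= rho.
Proof.
move=> uJ ga; have b0 := ballmu_gt0 normN.
have sumw : \sum_(j < J) share (D u) j = ballmu N.
  rewrite share_sum -(mu_nball N u); congr mu; exact/setIidPl.
have -> : average J g u - a = (ballmu N)^-1 *: \sum_(j < J) share (D u) j *: (g j - a).
  under eq_bigr do rewrite scalerBr.
  by rewrite sumrB -scaler_suml sumw scalerBr scalerA mulVf ?gt_eqF// scale1r.
rewrite normrZ gtr0_norm ?invr_gt0// ler_pdivrMl// mulrC -sumw mulr_sumr.
apply: (le_trans (ler_norm_sum _ _ _)); apply: ler_sum => j _.
have s0 : 0 <= share (D u) j by apply: share_ge0; exact: (nball_sublevel normN).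
rewrite normrZ ger0_norm// mulrC.
have [[y uy Qy]|/share_eq0->] := pselect (exists2 y, D u y & Q j y).
  by apply: ler_wpM2l => //; exact: ga uy Qy.
by rewrite !mul0r.
Qed.

(** The total weight is the same at u and v, so the value a may be subtracted
    from g; what remains is weighted by the symmetric difference of the balls. *)
Lemma average_diff J g u v a (rho : R) : D u `<=` initial J -> D v `<=` initial J ->
  0 <= rho ->
  (forall j y, D u y -> Q j y -> `|g j - a| <= rho) ->
  (forall j y, D v y -> Q j y -> `|g j - a| <= rho) ->
  `|average J g u - average J g v| <= rho * shift_cost N (u - v).
Proof.
move=> uJ vJ rho0 ua va; have b0 := ballmu_gt0 normN.
have sumw w : D w `<=` initial J -> \sum_(j < J) share (D w) j = ballmu N.
  by move=> wJ; rewrite share_sum -(mu_nball N w); congr mu; exact/setIidPl.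
have -> : average J g u - average J g v = (ballmu N)^-1 *:
    \sum_(j < J) (share (D u `\` D v) j - share (D v `\` D u) j) *: (g j - a).
  rewrite -scalerBr (weighted_sum_diff g a); last by rewrite sumrB !sumw// subrr.
  congr (_ *: _); apply: eq_bigr => j _; congr (_ *: _).
  by rewrite (share_split u v) (share_split v u) [D v `&` D u]setIC; ring.
rewrite normrZ gtr0_norm ?invr_gt0// ler_pdivrMl//.
rewrite mulrCA [ballmu N * _]mulrC -(shift_costE normN).
apply: (le_trans (ler_norm_sum _ _ _)).
have uv0 (x y : 'rV[R]_m.+1) : D x `\` D y `<=` sublevel N (1 + N x).
  by move=> z [/(nball_sublevel normN)].
apply: (@le_trans _ _ (\sum_(j < J) rho *
    (share (D u `\` D v) j + share (D v `\` D u) j))); last first.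
  rewrite -mulr_sumr ler_wpM2l// big_split/=.
  by apply: lerD; apply: share_sum_le; exact: uv0.
apply: ler_sum => j _; rewrite normrZ mulrC.
have s1 : 0 <= share (D u `\` D v) j by apply: share_ge0; exact: uv0.
have s2 : 0 <= share (D v `\` D u) j by apply: share_ge0; exact: uv0.
have [[y uvy Qy]|uvQ] := pselect (exists2 y, (D u `|` D v) y & Q j y).
  apply: ler_pM => //; first by case: uvy => wy; [exact: ua wy Qy|exact: va wy Qy].
  by rewrite ler_norml; lra.
rewrite !share_eq0 ?subrr ?normr0 ?addr0 ?mulr0//.
  by move=> [y [vy _] Qy]; apply: uvQ; exists y => //; right.
by move=> [y [uy _] Qy]; apply: uvQ; exists y => //; left.
Qed.

End weights.

(** * Lipschitz extension by averaging at dyadic scales *)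

Lemma dyadic_scale (R : realType) (t : R) : 0 < t ->
  exists k : int, (2 ^ k <= t < 2 * 2 ^ k).
Proof.
move=> t0; have ln2 : 0 < ln 2 :> R by rewrite ln_gt0// ltr1n.
have two (k : int) : 2 ^ k = expR (k%:~R * ln 2) :> R.
  by rewrite -powR_intmul// /powR pnatr_eq0.
exists (Num.floor (ln t / ln 2)).
have /andP[x1 x2] := floor_itv (ln t / ln 2).
have -> : 2 * 2 ^ Num.floor (ln t / ln 2) = 2 ^ (Num.floor (ln t / ln 2) + 1) :> R.
  by rewrite expfzDr ?pnatr_eq0// expr1z mulrC.
rewrite !two -[t in (_ <= t) && _]lnK ?posrE// -[X in _ && (X < _)]lnK ?posrE//.
by rewrite ler_expR ltr_expR -ler_pdivlMr// -ltr_pdivrMr// x1.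
Qed.

Lemma convex_norm_le (R : realType) (V : normedModType R) (a b B : R) (u v : V) :
  0 <= a -> 0 <= b -> a + b = 1 -> `|u| <= B -> `|v| <= B -> `|a *: u + b *: v| <= B.
Proof.
move=> a0 b0 ab1 uB vB; apply: (le_trans (ler_normD _ _)).
rewrite !normrZ !ger0_norm// -[leRHS]mul1r -ab1 mulrDl.
by apply: lerD; apply: ler_wpM2l.
Qed.

Lemma comb_sub (R : pzRingType) (V : lmodType R) (a b : R) (u v u' v' : V) :
  a *: u + b *: v - (a *: u' + b *: v') = a *: (u - u') + b *: (v - v').
Proof. by rewrite opprD addrACA -!scalerBr. Qed.

Section extension.
Context {R : realType} {m : nat} (N : 'rV[R]_m.+1 -> R).
Hypothesis normN : is_norm N.
Context {Z : completeNormedModType R} (S : set 'rV[R]_m.+1) (f : 'rV[R]_m.+1 -> Z)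
  (K : R).
Hypothesis S0 : S !=set0.
Hypothesis K0 : 0 <= K.
Hypothesis fK : forall x y, S x -> S y -> `|f x - f y| <= K * N (x - y).

Definition set_dist x : R := inf [set N (x - s) | s in S].

Lemma set_dist_has_inf x : has_inf [set N (x - s) | s in S].
Proof.
split; first by case: S0 => s Ss; exists (N (x - s)); exists s.
by exists 0 => _ [s _ <-]; exact: norm_ge0.
Qed.

Lemma set_dist_ge0 x : 0 <= set_dist x.
Proof.
apply: lb_le_inf; first by have [] := set_dist_has_inf x.
by move=> _ [s _ <-]; exact: norm_ge0.
Qed.

Lemma set_dist_le x s : S s -> set_dist x <= N (x - s).
Proof. by move=> Ss; apply: ge_inf; [exact: (set_dist_has_inf x).2|exists s]. Qed.

Lemma set_dist_adherent x e : 0 < e -> exists2 s, S s & N (x - s) < set_dist x + e.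
Proof.
move=> e0; have [_ [s Ss <-] h] := inf_adherent e0 (set_dist_has_inf x).
by exists s.
Qed.

Lemma set_dist_lip x y : set_dist x <= set_dist y + N (x - y).
Proof.
apply/ler_addgt0Pr => e e0; have [s Ss ys] := set_dist_adherent y e0.
apply: le_trans (set_dist_le x Ss) _.
by have := norm_triangle normN y x s; lra.
Qed.

(** At a point of the closure of S the values of f at nearby points of S form a
    Cauchy sequence. *)
Lemma closure_value x : set_dist x = 0 ->
  exists v : Z, forall s, S s -> `|v - f s| <= K * N (x - s).
Proof.
move=> x0.
have sP (i : nat) : exists s, S s /\ N (x - s) < i.+1%:R^-1.
  have i0 : 0 < i.+1%:R^-1 :> R by rewrite invr_gt0.
  by have [s Ss] := set_dist_adherent x i0; rewrite x0 add0r; exists s.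
have {sP}/choice[s sP] := sP.
pose u i := f (s i).
have us i a : S a -> `|u i - f a| <= K * (i.+1%:R^-1 + N (x - a)).
  move=> Sa; have [Si xi] := sP i; apply: le_trans (fK Si Sa) _.
  rewrite ler_wpM2l//; apply: le_trans (norm_triangle normN x _ _) _.
  by rewrite lerD2r (normBC normN) ltW.
have small e : 0 < e -> \forall i \near \oo, K * i.+1%:R^-1 < e.
  move=> e0; have Ke0 : 0 <= K / e by rewrite divr_ge0// ltW.
  exists (Num.truncn (K / e)) => // i /= iKe.
  rewrite ltr_pdivrMr// mulrC -ltr_pdivrMr//.
  have /andP[_] := truncn_itv Ke0; move=> /lt_le_trans; apply.
  by rewrite ler_nat ltnS.
have uu i k : `|u k - u i| <= K * k.+1%:R^-1 + K * i.+1%:R^-1.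
  have [Si xi] := sP i; rewrite -mulrDr; apply: le_trans (us k _ Si) _.
  by rewrite ler_wpM2l// lerD2l ltW.
have cau : cauchy (u @ \oo).
  apply: cauchy_exP => e e0; have e20 : 0 < e / 2 by rewrite divr_gt0.
  have [k _ ke] := small _ e20; exists (u k).
  suff : \forall i \near \oo, ball (u k) e (u i) by [].
  near=> i; rewrite /= -ball_normE/=; apply: (le_lt_trans (uu _ _)).
  rewrite [e]splitr; apply: ltrD; first exact: (ke k (leqnn k)).
  by near: i; exact: small.
have /cvg_ex[/= v uv] : cvg (u @ \oo) by exact: cauchy_cvg.
exists v => a Sa; apply/ler_addgt0Pr => e e0.
have e20 : 0 < e / 2 by rewrite divr_gt0.
near \oo => i.
have h1 : `|v - u i| < e / 2.
  by near: i; move/cvgrPdist_lt : uv; apply.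
have h2 : K * i.+1%:R^-1 < e / 2 by near: i; exact: small.
have h3 := us i _ Sa; rewrite mulrDr in h3.
rewrite -(subrKA (u i)); apply: (le_trans (ler_normD _ _)).
set b := K * i.+1%:R^-1 in h2 h3; lra.
Unshelve. all: by end_near. Qed.

Context (Q : nat -> set 'rV[R]_m.+1).
Hypothesis Qdiam : forall j x y, Q j x -> Q j y -> N (x - y) <= 1.
Hypothesis Qfin : forall r, exists J, forall x, N x <= r -> exists2 j, (j < J)%N & Q j x.

(** If some point of S is within 6 r of the j-th piece dilated by r, choose such
    a point. This is the case for all pieces that meet a ball of radius r around
    a point at distance at most 4 r from S, as S has a point within 5 r of the
    centre. *)
Lemma site_exists (r : R) (j : nat) : exists s, S s /\
  ((exists s y, [/\ S s, Q j y & N (r *: y - s) <= 6 * r]) ->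
    exists2 y, Q j y & N (r *: y - s) <= 6 * r).
Proof.
have [[s [y [Ss Qy ys]]]|no] :=
  pselect (exists s y, [/\ S s, Q j y & N (r *: y - s) <= 6 * r]).
  by exists s; split => // _; exists y.
by case: S0 => s Ss; exists s.
Qed.

Definition site (r : R) (j : nat) : 'rV[R]_m.+1 := projT1 (cid (site_exists r j)).

Lemma site_in r j : S (site r j).
Proof. by rewrite /site; case: cid => s []. Qed.

Lemma site_near (r : R) (j : nat) x y : 0 < r -> set_dist x <= 4 * r ->
  nball N (r^-1 *: x) y -> Q j y -> N (site r j - x) <= 8 * r.
Proof.
move=> r0 xr xy Qy.
have yx : N (r *: y - x) <= r.
  have -> : r *: y - x = r *: (y - r^-1 *: x).
    by rewrite scalerBr scalerA divff ?gt_eqF// scale1r.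
  by rewrite (is_normZ normN) gtr0_norm// -[leRHS]mulr1 ler_pM2l.
have [s0 Ss0 xs0] := set_dist_adherent x r0.
have [y' Qy' ys] : exists2 y, Q j y & N (r *: y - site r j) <= 6 * r.
  rewrite /site; case: cid => s [Ss]; apply; exists s0, y; split => //.
  have := norm_triangle normN x (r *: y) s0; lra.
have h1 : N (r *: y' - r *: y) <= r.
  rewrite -scalerBr (is_normZ normN) gtr0_norm// -[leRHS]mulr1 ler_pM2l//.
  exact: Qdiam Qy' Qy.
have := norm_triangle normN (r *: y') (site r j) x.
have := norm_triangle normN (r *: y) (r *: y') x.
by rewrite (normBC normN (site r j) (r *: y')); lra.
Qed.

Lemma stage_exists u : exists J, nball N u `<=` initial Q J.
Proof.
have [J JP] := Qfin (1 + N u); exists J => x /(nball_sublevel normN) /JP[j jJ Qj].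
by exists j.
Qed.

Definition stage u : nat := projT1 (cid (stage_exists u)).

Lemma stageP u : nball N u `<=` initial Q (stage u).
Proof. by rewrite /stage; case: cid. Qed.

(** The average at scale r around x, written in coordinates dilated by 1/r so
    that the ball always has radius 1. *)
Definition smooth (r : R) x : Z :=
  average N Q (stage (r^-1 *: x)) (fun j => f (site r j)) (r^-1 *: x).

Lemma site_value_near (r : R) j x y s : 0 < r -> set_dist x <= 4 * r -> S s ->
  nball N (r^-1 *: x) y -> Q j y -> `|f (site r j) - f s| <= K * (8 * r + N (x - s)).
Proof.
move=> r0 xr Ss xy Qy; apply: le_trans (fK (site_in r j) Ss) _.
rewrite ler_wpM2l//; have := norm_triangle normN x (site r j) s.
have := site_near r0 xr xy Qy; lra.
Qed.

Lemma smooth_near (r : R) x s : 0 < r -> set_dist x <= 4 * r -> S s ->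
  `|smooth r x - f s| <= K * (8 * r + N (x - s)).
Proof.
move=> r0 xr Ss; apply: average_near => //; first exact: stageP.
by move=> j y xy Qy; exact: (@site_value_near r j x y s).
Qed.

Lemma smooth_diff (r : R) x y : 0 < r -> set_dist x <= 4 * r -> set_dist y <= 4 * r ->
  N (x - y) <= r ->
  `|smooth r x - smooth r y| <= K * (14 * r) * shift_cost N (r^-1 *: (x - y)).
Proof.
move=> r0 xr yr xyr; have [s Ss xs] := set_dist_adherent x r0.
have ys := norm_triangle normN x y s; rewrite (normBC normN y x) in ys.
rewrite /smooth scalerBr.
set J1 := stage _; set J2 := stage _.
rewrite -(@average_stable _ _ _ _ _ J1 (maxn J1 J2)) ?leq_maxl//; last exact: stageP.
rewrite -(@average_stable _ _ _ _ _ J2 (maxn J1 J2)) ?leq_maxr//; last exact: stageP.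
have inc J J' : (J <= J')%N -> initial Q J `<=` initial Q J'.
  by move=> JJ z [i iJ Qz]; exists i => //; exact: leq_trans JJ.
apply: (@average_diff _ _ _ normN _ _ _ _ _ _ (f s)).
- by apply: subset_trans (inc _ _ (leq_maxl _ _)); exact: stageP.
- by apply: subset_trans (inc _ _ (leq_maxr _ _)); exact: stageP.
- by rewrite !mulr_ge0// ltW.
- move=> j z xz Qz; apply: le_trans (site_value_near r0 xr Ss xz Qz) _.
  by rewrite ler_wpM2l//; lra.
- move=> j z yz Qz; apply: le_trans (site_value_near r0 yr Ss yz Qz) _.
  by rewrite ler_wpM2l//; lra.
Qed.

Lemma smooth_double (r : R) x : 0 < r -> set_dist x <= 4 * r ->
  `|smooth (2 * r) x - smooth r x| <= K * (34 * r).
Proof.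
move=> r0 xr; have [s Ss xs] := set_dist_adherent x r0.
have r20 : 0 < 2 * r by rewrite mulr_gt0.
have h1 : `|smooth (2 * r) x - f s| <= K * (21 * r).
  apply: le_trans (smooth_near r20 _ Ss) _; first by lra.
  by rewrite ler_wpM2l//; lra.
have h2 : `|smooth r x - f s| <= K * (13 * r).
  by apply: le_trans (smooth_near r0 xr Ss) _; rewrite ler_wpM2l//; lra.
rewrite -(subrKA (f s)); apply: (le_trans (ler_normD _ _)).
rewrite [X in _ + X]distrC; lra.
Qed.

(** The formula for one dyadic interval r <= t <= 2 r. The formulas for two
    consecutive intervals agree at the common end. *)
Definition interp (t r : R) x : Z :=
  (2 - t / r) *: smooth r x + (t / r - 1) *: smooth (2 * r) x.

Lemma interp_coeffs (t r : R) : 0 < r -> r <= t <= 2 * r ->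
  [/\ 0 <= 2 - t / r, 0 <= t / r - 1 & 2 - t / r + (t / r - 1) = 1].
Proof.
move=> r0 /andP[rt tr]; split; last by ring.
- by rewrite subr_ge0 ler_pdivrMr.
- by rewrite subr_ge0 ler_pdivlMr// mul1r.
Qed.

Lemma interp_near (t r : R) x s : 0 < r -> r <= t <= 2 * r ->
  set_dist x <= 4 * r -> S s -> `|interp t r x - f s| <= K * (16 * r + N (x - s)).
Proof.
move=> r0 rt xr Ss; have [a0 b0 ab1] := interp_coeffs r0 rt.
rewrite -[f s]scale1r -ab1 scalerDl /interp comb_sub.
apply: convex_norm_le => //.
  apply: le_trans (smooth_near r0 xr Ss) _; rewrite ler_wpM2l//; lra.
have r20 : 0 < 2 * r by rewrite mulr_gt0.
by apply: le_trans (smooth_near r20 _ Ss) _; [lra|rewrite ler_wpM2l//; lra].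
Qed.

Lemma interp_diff_point (t r : R) x y q : 0 < r -> r <= t <= 2 * r ->
  set_dist x <= 4 * r -> set_dist y <= 4 * r -> N (x - y) <= r ->
  (forall a, 0 < a -> a * shift_cost N (a^-1 *: (x - y)) <= q) ->
  `|interp t r x - interp t r y| <= K * 14 * q.
Proof.
move=> r0 rt xr yr xyr hq; have [a0 b0 ab1] := interp_coeffs r0 rt.
rewrite /interp comb_sub.
have diff a : 0 < a -> r <= a -> `|smooth a x - smooth a y| <= K * 14 * q.
  move=> a_gt0 ra; apply: le_trans (smooth_diff a_gt0 _ _ _) _; [lra..|].
  rewrite mulrA -[leLHS]mulrA ler_wpM2l//; last exact: hq.
  by rewrite mulr_ge0.
by apply: convex_norm_le => //; apply: diff; lra.
Qed.

Lemma interp_diff_time (t t' r : R) x : 0 < r -> set_dist x <= 4 * r ->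
  `|interp t r x - interp t' r x| <= K * 34 * `|t - t'|.
Proof.
move=> r0 xr.
have -> : interp t r x - interp t' r x =
    ((t - t') / r) *: (smooth (2 * r) x - smooth r x).
  rewrite /interp; set a := smooth r x; set b := smooth _ x.
  rewrite opprD addrACA -!scalerBl scalerBr -scaleNr addrC.
  by congr (_ *: _ + _ *: _); ring.
rewrite normrZ normrM normfV (gtr0_norm r0).
apply: le_trans (ler_wpM2l _ (smooth_double r0 xr)) _; first by rewrite divr_ge0// ltW.
by rewrite le_eqVlt; apply/orP; left; apply/eqP; field; rewrite gt_eqF.
Qed.

Lemma interp_left r x : 0 < r -> interp r r x = smooth r x.
Proof.
move=> r0; rewrite /interp divff ?gt_eqF// subrr scale0r addr0.
by rewrite (_ : 2 - 1 = 1) ?scale1r//; ring.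
Qed.

Lemma interp_right r x : 0 < r -> interp (2 * r) r x = smooth (2 * r) x.
Proof.
move=> r0; rewrite /interp mulfK ?gt_eqF// subrr scale0r add0r.
by rewrite (_ : 2 - 1 = 1) ?scale1r//; ring.
Qed.

(** Crossing a dyadic breakpoint costs nothing: both interpolations agree with
    the same average there. *)
Lemma interp_diff_scale (t t' : R) (k k' : int) x :
  2 ^ k <= t < 2 * 2 ^ k -> 2 ^ k' <= t' < 2 * 2 ^ k' -> t' <= t -> t <= 2 * t' ->
  set_dist x <= t' ->
  `|interp t (2 ^ k) x - interp t' (2 ^ k') x| <= K * 34 * (t - t').
Proof.
move=> /andP[kt tk] /andP[kt' tk'] tt tt2 xt'.
have two0 (i : int) : 0 < 2 ^ i :> R by rewrite exprz_gt0.
have twoS (i : int) : 2 * 2 ^ i = 2 ^ (i + 1) :> R.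
  by rewrite expfzDr ?pnatr_eq0// expr1z mulrC.
have k'k : (k' <= k)%R.
  rewrite -ltzD1 -(ltr_eXz2l (ltr1n R 2)) -twoS.
  exact: le_lt_trans (le_lt_trans tt tk).
have kk' : (k <= k' + 1)%R.
  rewrite -ltzD1 -(ltr_eXz2l (ltr1n R 2)) -!twoS.
  apply: le_lt_trans kt (le_lt_trans tt2 _); rewrite ltr_pM2l//.
have x4 : set_dist x <= 4 * 2 ^ k' by apply: le_trans xt' _; have := two0 k'; lra.
have [kE|kN] := eqVneq k k'.
  rewrite kE; apply: le_trans (interp_diff_time _ _ (two0 _) x4) _.
  by rewrite ger0_norm ?subr_ge0.
have {kN}kE : k = k' + 1.
  apply/eqP; rewrite eq_le kk' /= -[k' + 1]addrC.
  by rewrite lez1D lt_neqAle k'k andbT eq_sym.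
have k2 : 2 ^ k = 2 * 2 ^ k' :> R by rewrite kE twoS.
rewrite -(subrKA (smooth (2 ^ k) x)); apply: (le_trans (ler_normD _ _)).
have h1 : `|interp t (2 ^ k) x - smooth (2 ^ k) x| <= K * 34 * (t - 2 ^ k).
  rewrite -[X in `|_ - X|]interp_left//.
  apply: le_trans (interp_diff_time _ _ (two0 _) _) _.
    by rewrite k2; have := two0 k'; lra.
  by rewrite ger0_norm ?subr_ge0.
have h2 : `|smooth (2 ^ k) x - interp t' (2 ^ k') x| <= K * 34 * (2 ^ k - t').
  rewrite k2 -[X in `|X - _|]interp_right//.
  apply: le_trans (interp_diff_time _ _ (two0 _) x4) _.
  by rewrite ger0_norm// subr_ge0 ltW.
by apply: le_trans (lerD h1 h2) _; rewrite -mulrDr subrKA.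
Qed.

Lemma extension_value x : exists v : Z,
  (set_dist x = 0 -> forall s, S s -> `|v - f s| <= K * N (x - s)) /\
  (0 < set_dist x -> exists2 k : int, 2 ^ k <= set_dist x < 2 * 2 ^ k &
     v = interp (set_dist x) (2 ^ k) x).
Proof.
have [x0|xN0] := eqVneq (set_dist x) 0.
  have [v vP] := closure_value x0; exists v; split => [_|]; first exact: vP.
  by rewrite x0 ltxx.
have x_gt0 : 0 < set_dist x by rewrite lt_neqAle eq_sym xN0 set_dist_ge0.
have [k kP] := dyadic_scale x_gt0.
exists (interp (set_dist x) (2 ^ k) x); split => [x0|_]; last by exists k.
by rewrite x0 eqxx in xN0.
Qed.

(** At the scale a = N w / 4 the two balls are disjoint and the cost is 2. *)
Lemma shift_cost_ge_norm (w : 'rV[R]_m.+1) q : w != 0 ->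
  (forall a, 0 < a -> a * shift_cost N (a^-1 *: w) <= q) -> N w <= 2 * q.
Proof.
move=> w0 hq; have Nw0 : 0 < N w by exact: norm_gt0.
have a0 : 0 < N w / 4 by rewrite divr_gt0.
have := hq _ a0; rewrite far_shift_cost//; first by lra.
rewrite (is_normZ normN) gtr0_norm ?invr_gt0// invf_div mulfVK ?gt_eqF//.
by lra.
Qed.

(** Two points that are far from each other compared with their distances to S
    are compared through f; two points that are close are compared first at the
    same scale and then at the same point. *)
Lemma shift_cost_extension : exists F : 'rV[R]_m.+1 -> Z,
  (forall s, S s -> F s = f s) /\
  forall x y q, x != y ->
    (forall a, 0 < a -> a * shift_cost N (a^-1 *: (x - y)) <= q) ->
    `|F x - F y| <= 1000 * K * q.
Proof.
have [F FP] := choice extension_value.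
have Fnear x s : S s -> `|F x - f s| <= K * (16 * set_dist x + N (x - s)).
  move=> Ss; have [F0 Fpos] := FP x.
  have [x0|xN0] := eqVneq (set_dist x) 0.
    by rewrite x0 mulr0 add0r; exact: F0.
  have x_gt0 : 0 < set_dist x by rewrite lt_neqAle eq_sym xN0 set_dist_ge0.
  have [k /andP[k1 k2] ->] := Fpos x_gt0.
  have two0 : 0 < 2 ^ k :> R by rewrite exprz_gt0.
  apply: le_trans (interp_near two0 _ _ Ss) _.
  - by rewrite k1 ltW.
  - by lra.
  - by rewrite ler_wpM2l//; lra.
exists F; split.
  move=> s Ss; have s0 : set_dist s = 0.
    apply/eqP; rewrite eq_le set_dist_ge0 andbT.
    by apply: le_trans (set_dist_le s Ss) _; rewrite subrr norm0.
  have := Fnear s s Ss; rewrite s0 subrr norm0// mulr0 addr0 mulr0 normr_le0.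
  by rewrite subr_eq0 => /eqP.
have main x y q : x != y ->
    (forall a, 0 < a -> a * shift_cost N (a^-1 *: (x - y)) <= q) ->
    set_dist y <= set_dist x -> `|F x - F y| <= 1000 * K * q.
  move=> xy hq yx; have w0 : x - y != 0 by rewrite subr_eq0.
  have Nq := shift_cost_ge_norm w0 hq.
  have Nxy0 : 0 < N (x - y) by exact: norm_gt0.
  have q0 : 0 <= q by lra.
  have y0 := set_dist_ge0 y.
  have xyd := set_dist_lip x y.
  have [far|close] := leP (set_dist x) (8 * N (x - y)).
    have [s Ss xs] := set_dist_adherent x Nxy0.
    rewrite -(subrKA (f s)); apply: (le_trans (ler_normD _ _)).
    rewrite [X in _ + X]distrC; apply: le_trans (lerD (Fnear x s Ss) (Fnear y s Ss)) _.
    have := norm_triangle normN x y s; rewrite (normBC normN y x) => ys.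
    have -> : 1000 * K * q = K * (1000 * q) by ring.
    by rewrite -mulrDr ler_wpM2l//; lra.
  have x_gt0 : 0 < set_dist x by lra.
  have y_gt0 : 0 < set_dist y by lra.
  have [k kP ->] := (FP x).2 x_gt0.
  have [k' kP' ->] := (FP y).2 y_gt0.
  have two0 : 0 < 2 ^ k :> R by rewrite exprz_gt0.
  have /andP[k1 k2] := kP.
  rewrite -(subrKA (interp (set_dist x) (2 ^ k) y)); apply: (le_trans (ler_normD _ _)).
  have h1 : `|interp (set_dist x) (2 ^ k) x - interp (set_dist x) (2 ^ k) y| <= K * 14 * q.
    apply: interp_diff_point => //; [|lra..].
    by rewrite k1 ltW.
  have h2 : `|interp (set_dist x) (2 ^ k) y - interp (set_dist y) (2 ^ k') y| <=
      K * 34 * (set_dist x - set_dist y).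
    by apply: interp_diff_scale => //; lra.
  apply: le_trans (lerD h1 h2) _; rewrite -!mulrA -mulrDr mulrCA ler_wpM2l//.
  by lra.
move=> x y q xy hq; have [yx|/ltW xy'] := leP (set_dist y) (set_dist x).
  exact: main.
rewrite distrC; refine (main y x q _ _ xy'); first by rewrite eq_sym.
by move=> a a0; rewrite -opprB scalerN shift_costN; exact: hq.
Qed.

End extension.

(** * Shadows and the extension modulus *)

(** Every Lipschitz inequality is a closed condition on the constant. *)
Lemma lip_const_attained (R : realType) (T : Type) (d : T -> T -> R)
    (Z : normedModType R) (S : set T) (f : T -> Z) :
  (forall x y, 0 <= d x y) -> (lip_const d S f < +oo)%E ->
  exists2 K : R, 0 <= K & lip_const d S f = K%:E /\
    forall x y, S x -> S y -> `|f x - f y| <= K * d x y.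
Proof.
move=> d0 ffin.
have f0 : (0 <= lip_const d S f)%E.
  by apply: le_ereal_inf_tmp => _ [K [K0 _] <-]; rewrite lee_fin.
have fE : lip_const d S f = (fine (lip_const d S f))%:E by rewrite fineK// ge0_fin_numE.
exists (fine (lip_const d S f)); first by rewrite fine_ge0.
split => // x y Sx Sy; have [dxy|dxy] := eqVneq (d x y) 0.
  have [_ [K [_ KP] <-] _] := ereal_inf_lt ffin.
  by have := KP x y Sx Sy; rewrite dxy !mulr0.
have dxy0 : 0 < d x y by rewrite lt_neqAle eq_sym dxy d0.
rewrite -ler_pdivrMr// -lee_fin -fE.
by apply: le_ereal_inf_tmp => _ [K [_ KP] <-]; rewrite lee_fin ler_pdivrMr// KP.
Qed.

Section shadow.
Context {R : realType} {m : nat} (N : 'rV[R]_m.+1 -> R).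
Hypothesis normN : is_norm N.

Lemma unit_ballE : unit_ball N = nball N 0.
Proof. by apply/seteqP; split => y; rewrite /nball/unit_ball/= subr0. Qed.

Lemma proj_perpZ (a : R) (w : 'rV[R]_m.+1) : a != 0 -> proj_perp (a *: w) = proj_perp w.
Proof.
move=> a0; apply/funext => x; rewrite /proj_perp dotZ [dot x (a *: w)]dotC dotZl.
rewrite [dot w x]dotC scalerA; congr (_ - _ *: _).
have [->|w0] := eqVneq (dot w w) 0; first by rewrite mulr0 invr0 !mulr0 mul0r.
by field; rewrite a0 w0.
Qed.

Definition shadow w : \bar R := hsd m (proj_perp w @` unit_ball N).

Lemma shadow_ge0 w : (0 <= shadow w)%E.
Proof. by apply: hausdorff_ge0; exact: norm_dist2_xx. Qed.

Lemma vol_ratioE w :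
  (vol m (proj_perp w @` unit_ball N) / vol m.+1 (unit_ball N) =
   (@cube_measure R m.+1 / @cube_measure R m / ballmu N)%:E * shadow w)%E.
Proof.
have h0 := @cube_measure_gt0 R m; have h1 := @cube_measure_gt0 R m.+1.
have b0 := ballmu_gt0 normN.
rewrite /vol !cube_measureE -/(shadow w) unit_ballE.
have -> : hausdorff (norm_dist (@norm2 R m.+1)) m.+1 (nball N 0) = (ballmu N)%:E.
  rewrite /ballmu /mu fineK//.
  exact: (hsd_bounded_fin normN (nball_sublevel normN (v:=0))).
rewrite !inver !gt_eqF// -EFinM inver gt_eqF ?divr_gt0//.
rewrite -muleA muleC -EFinM; congr (EFin _ * _)%E.
by field; rewrite !gt_eqF.
Qed.

Lemma shift_cost_le_shadow w (p : R) : w != 0 -> shadow w = p%:E ->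
  forall a, 0 < a -> a * shift_cost N (a^-1 *: w) <=
    4 * norm2 w * (@cube_measure R m.+1 / @cube_measure R m / ballmu N * p).
Proof.
move=> w0 wp a a0; have b0 := ballmu_gt0 normN.
set c := @cube_measure R m.+1 / @cube_measure R m.
have diff (t : R) : t != 0 -> `|t| = a^-1 ->
    mu (nball N (t *: w) `\` nball N 0) <= 2 * (a^-1 * norm2 w) * c * p.
  move=> t0 ta; have tw0 : t *: w != 0 by rewrite scaler_eq0 negb_or t0.
  have := hsd_translate_diff normN tw0.
  rewrite proj_perpZ// -/(shadow w) wp norm2Z ta -EFinM /mu -lee_fin fineK//.
  by apply: (@hsd_bounded_fin _ _ _ normN (1 + N (t *: w))) => y [/(nball_sublevel normN)].
have aV0 : 0 < a^-1 by rewrite invr_gt0.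
have h1 := diff a^-1; have h2 := diff (- a^-1).
rewrite gt_eqF// gtr0_norm// in h1; have {}h1 := h1 isT erefl.
rewrite oppr_eq0 gt_eqF// normrN gtr0_norm// in h2; have {}h2 := h2 isT erefl.
rewrite scaleNr in h2; rewrite /shift_cost [leLHS]mulrA ler_pdivrMr//.
rewrite -ler_pdivlMl//; apply: le_trans (lerD h1 h2) _.
rewrite le_eqVlt; apply/orP; left; apply/eqP; field.
by rewrite !gt_eqF// cube_measure_gt0.
Qed.

Lemma norm_le_shadow w p : w != 0 -> shadow w = p%:E ->
  N w <= 8 * norm2 w * (@cube_measure R m.+1 / @cube_measure R m / ballmu N * p).
Proof.
move=> w0 wp; have := shift_cost_ge_norm normN w0 (shift_cost_le_shadow w0 wp).
by rewrite !mulrA -natrM.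
Qed.

End shadow.

(** An infinite supremum makes the bound trivial, as the other one is positive.
    The factor 4 bounds the cost of a shift by the shadow: there is a factor 2
    from the shrunk balls and a factor 2 from the two halves of the symmetric
    difference. The equation fixing C keeps the literal out of computations. *)
Lemma lip_ext_modulus_le (R : realType) (C : R) (m : nat) (NX NY : 'rV[R]_m.+1 -> R)
    (A : set 'rV[R]_m.+1) : 0 < C -> C = 4 * 1000 -> is_norm NX -> is_norm NY ->
  (exists x y, [/\ A x, A y & x <> y]) ->
  (lip_ext_modulus (norm_dist NX) A <=
    C%:E *
    ereal_sup [set t | exists x y, [/\ A x, A y, x <> y &
      t = (NX (x - y) / NY (x - y))%:E]] *
    ereal_sup [set t | exists x y, [/\ A x, A y, x <> y &
      t = vol m (proj_perp (x - y)%R @` unit_ball NY) / vol m.+1 (unit_ball NY)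
          * (norm2 (x - y) / NX (x - y))%:E]])%E.
Proof.
move=> C_gt0 CE normX normY [x0 [y0 [Ax0 Ay0 xy0]]].
set SM := [set t | _]; set SQ := [set t | _].
have b0 := ballmu_gt0 normY.
pose c := @cube_measure R m.+1 / @cube_measure R m / ballmu NY.
have c0 : 0 < c by rewrite !divr_gt0 ?cube_measure_gt0.
have X0 w : w != 0 -> 0 < NX w by exact: norm_gt0.
have Y0 w : w != 0 -> 0 < NY w by exact: norm_gt0.
have sub0 (x y : 'rV[R]_m.+1) : x <> y -> x - y != 0 by move/eqP; rewrite subr_eq0.
have n20 (w : 'rV[R]_m.+1) : w != 0 -> 0 < norm2 w.
  move=> w0; rewrite lt_neqAle norm2_ge0 andbT eq_sym.
  by apply: contra_neq w0; exact: norm2_eq0.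
have shadow_pos w : w != 0 -> (0 < shadow NY w)%E.
  move=> w0; rewrite lt_neqAle shadow_ge0 andbT; apply/eqP => s0.
  by have := norm_le_shadow normY w0 (esym s0); rewrite !mulr0 leNgt Y0.
have w0 := sub0 _ _ xy0.
have M0 : (0 < ereal_sup SM)%E.
  apply: (@lt_le_trans _ _ (NX (x0 - y0) / NY (x0 - y0))%:E).
    by rewrite lte_fin divr_gt0 ?X0 ?Y0.
  by apply: ereal_sup_ubound; exists x0, y0.
have Qge x y : A x -> A y -> x <> y -> 
    (c%:E * shadow NY (x - y) * (norm2 (x - y) / NX (x - y))%:E <= ereal_sup SQ)%E.
  move=> Ax Ay xy; apply: ereal_sup_ubound; exists x, y; split => //.
  by rewrite (vol_ratioE normY).
have Q0 : (0 < ereal_sup SQ)%E.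
  apply: lt_le_trans (Qge _ _ Ax0 Ay0 xy0).
  rewrite !mule_gt0 ?lte_fin ?shadow_pos//.
  by rewrite divr_gt0 ?n20 ?X0.
have C0 : (0 < C%:E)%E by rewrite lte_fin.
have [Moo|Mfin] := eqVneq (ereal_sup SM) +oo%E.
  by rewrite Moo gt0_muley// gt0_mulye// leey.
have [Qoo|Qfin] := eqVneq (ereal_sup SQ) +oo%E.
  by rewrite Qoo gt0_muley ?leey// mule_gt0.
have {}Mfin : ereal_sup SM \is a fin_num by rewrite ge0_fin_numE ?ltey// ltW.
have {}Qfin : ereal_sup SQ \is a fin_num by rewrite ge0_fin_numE ?ltey// ltW.
rewrite -(fineK Mfin) -(fineK Qfin); set M := fine _; set Q := fine _.
have M_gt0 : 0 < M by rewrite -lte_fin /M fineK.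
have Q_gt0 : 0 < Q by rewrite -lte_fin /Q fineK.
have XM x y : A x -> A y -> NX (x - y) <= M * NY (x - y).
  move=> Ax Ay; have [->|xy] := eqVneq x y.
    by rewrite subrr !norm0 ?mulr0.
  have xy' : x - y != 0 by rewrite subr_eq0.
  rewrite -ler_pdivrMr ?Y0// -lee_fin /M fineK//.
  by apply: ereal_sup_ubound; exists x, y; split => //; exact/eqP.
have shadowQ x y : A x -> A y -> x <> y -> exists2 p, shadow NY (x - y) = p%:E &
    norm2 (x - y) * (c * p) <= NX (x - y) * Q.
  move=> Ax Ay xy; have := Qge _ _ Ax Ay xy; have w1 := sub0 _ _ xy.
  have r0 : 0 < norm2 (x - y) / NX (x - y) by rewrite divr_gt0 ?n20 ?X0.
  rewrite -(fineK Qfin) -/Q; have := shadow_pos _ w1.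
  case: (shadow NY (x - y)) => [p _| |//].
    rewrite -!EFinM lee_fin => h; exists p => //.
    rewrite [leRHS]mulrC -ler_pdivrMr ?X0//; apply: le_trans h.
    by rewrite le_eqVlt; apply/orP; left; apply/eqP; ring.
  by rewrite gt0_muley ?lte_fin// gt0_mulye ?lte_fin.
rewrite -!EFinM; apply: ereal_inf_lbound; split.
  rewrite lee_fin; have [p pE pQ] := shadowQ _ _ Ax0 Ay0 xy0.
  have := norm_le_shadow normY w0 pE; rewrite -/c => h.
  have : NX (x0 - y0) <= M * (8 * (NX (x0 - y0) * Q)).
    apply: le_trans (XM _ _ Ax0 Ay0) _; rewrite ler_pM2l//.
    by apply: le_trans h _; rewrite -mulrA ler_pM2l.
  have -> : M * (8 * (NX (x0 - y0) * Q)) = (8 * M * Q) * NX (x0 - y0) by ring.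
  rewrite -[leLHS]mul1r ler_pM2r ?X0// => h8.
  have : 8 * M * Q <= C * M * Q.
    by rewrite ler_pM2r// ler_pM2r// CE; lra.
  exact: le_trans.
move=> S S0 SA Z f ffin.
have dX0 x y : 0 <= norm_dist NX x y by exact: (norm_ge0 normX).
have [K K0 [KE fK]] := lip_const_attained dX0 ffin.
have KM0 : 0 <= K * M by rewrite mulr_ge0// ltW.
have fKM x y : S x -> S y -> `|f x - f y| <= K * M * NY (x - y).
  move=> Sx Sy; apply: le_trans (fK _ _ Sx Sy) _; rewrite -mulrA ler_wpM2l//.
  by apply: XM; exact: SA.
have [cells [cellsD cellsF]] := locally_finite_cover normY.
have [F [FS FL]] := shift_cost_extension normY S0 KM0 fKM cellsD cellsF.
exists F; split => //; rewrite KE -EFinM; apply: ereal_inf_lbound.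
exists (C * M * Q * K) => //=; split.
  by rewrite mulr_ge0// mulr_ge0 ?ltW// mulr_gt0.
move=> x y Ax Ay; have [->|xy] := eqVneq x y.
  by rewrite subrr normr0 mulr_ge0// mulr_ge0// mulr_ge0 ?ltW// mulr_gt0.
have [p pE pQ] := shadowQ _ _ Ax Ay (elimN eqP xy).
have w1 : x - y != 0 by rewrite subr_eq0.
apply: (le_trans (FL _ _ _ xy (shift_cost_le_shadow normY w1 pE))).
rewrite -/c -[4 * _ * _]mulrA.
have -> : C * M * Q * K * norm_dist NX x y =
  1000 * (K * M) * (4 * (NX (x - y) * Q)) by rewrite CE /norm_dist; ring.
apply: ler_wpM2l; first by apply: mulr_ge0; [exact: ler0n|exact: KM0].
by apply: ler_wpM2l; [exact: ler0n|exact: pQ].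
Qed.

Local Open Scope ereal_scope.

Theorem theorem21 (R : realType) :
  exists C : R, (0 < C)%R /\
  forall (n : nat) (NX NY : 'rV[R]_n -> R), (0 < n)%N ->
    is_norm NX -> is_norm NY ->
  forall A : set 'rV[R]_n, (exists x y, [/\ A x, A y & x <> y]) ->
  lip_ext_modulus (norm_dist NX) A <=
    C%:E *
    ereal_sup [set t | exists x y, [/\ A x, A y, x <> y &
      t = (NX (x - y) / NY (x - y))%:E]] *
    ereal_sup [set t | exists x y, [/\ A x, A y, x <> y &
      t = vol n.-1 (proj_perp (x - y)%R @` unit_ball NY) / vol n (unit_ball NY)
          * (norm2 (x - y) / NX (x - y))%:E]].
Proof.
have [C C_gt0 CE] : exists2 C : R, (0 < C)%R & C = (4 * 1000)%R.
  by exists (4 * 1000)%R; rewrite ?mulr_gt0 ?ltr0n.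
exists C; split => // -[//|m] NX NY _ normX normY A A2.
exact: lip_ext_modulus_le.
Qed.
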